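(* Let $R$ be a commutative Noetherian ring of finite Krull dimension, $\mathfrak{a}$ an ideal of $R$, and $M$ an $R$-module whose cohomological dimension $\mathrm{cd}(\mathfrak{a},M)$ is finite (i.e. is an integer). Then there exists $\mathfrak{p}\in\mathrm{Supp}_R(M)$ such that $\mathrm{cd}(\mathfrak{a},M)\le \mathrm{cd}(\mathfrak{a},R/\mathfrak{p})$. Moreover, if $M$ is finitely generated, then there exists a minimal element $\mathfrak{p}$ of $\mathrm{Supp}_R(M)$ such that $\mathrm{cd}(\mathfrak{a},M)=\mathrm{cd}(\mathfrak{a},R/\mathfrak{p})$.
   Context: For an $R$-module $M$, $\Gamma_{\mathfrak{a}}(M)$ is the submodule of elements annihilated by some power of $\mathfrak{a}$, and $H^i_{\mathfrak{a}}(M)$ is the $i$-th right derived functor of $\Gamma_{\mathfrak{a}}$ applied to $M$. The cohomological dimension is $\mathrm{cd}(\mathfrak{a},M)=\sup\{i\in\mathbb{Z}\mid H^i_{\mathfrak{a}}(M)\neq 0\}$, with $\sup\emptyset=-\infty$. Minimal elements of $\mathrm{Supp}_R(M)$ are taken with respect to inclusion. *)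

(* Defs.v *)
From HB Require Import structures.
From mathcomp Require Import all_boot all_order all_algebra.
From mathcomp Require Import boolp classical_sets constructive_ereal.

Set Implicit Arguments.
Unset Strict Implicit.
Unset Printing Implicit Defensive.

Import Order.TTheory GRing.Theory Num.Theory.

Local Open Scope classical_set_scope.
Local Open Scope ring_scope.
Local Open Scope quotient_scope.

(* An ideal is a submodule of the regular module, possibly the whole ring;    *)
(* boolean membership loses no generality in the presence of [asbool].        *)
Notation ideal R := (GRing.SubmodClosed.type (GRing.regular R)).

Section Submodules.
Variables (R : pzRingType) (M : lmodType R).

Definition submod_type (N : submodClosed M) := {x : M | x \in N}.

HB.instance Definition _ (N : submodClosed M) := SubChoice.on (submod_type N).
HB.instance Definition _ (N : submodClosed M) :=
  [SubChoice_isSubLmodule of submod_type N by <:].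

(* [submodClosed M] does not inherit from [zmodClosed M], which               *)
(* [Quotient.quot] expects                                                    *)
Definition submod_pred (N : submodClosed M) : {pred M} := fun x => x \in N.

Lemma submod_pred_zmod_closed N : zmod_closed (submod_pred N).
Proof. exact: GRing.submod_closedB (submodClosedP N). Qed.

HB.instance Definition _ N :=
  GRing.isZmodClosed.Build M (submod_pred N) (submod_pred_zmod_closed N).

Definition quot_mod (N : submodClosed M) := Quotient.quot (submod_pred N).

Section Quotient.
Variable N : submodClosed M.

HB.instance Definition _ := GRing.Zmodule.on (quot_mod N).

Definition quot_mod_pi (x : M) : quot_mod N := \pi_(Quotient.quot (submod_pred N)) x.

Definition quot_mod_scale (r : R) (u : quot_mod N) : quot_mod N :=
  quot_mod_pi (r *: repr (u : Quotient.quot (submod_pred N))).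

Lemma quot_mod_pi_eq x y : (quot_mod_pi x = quot_mod_pi y) <-> (x - y \in N).
Proof.
rewrite -[_ \in N]/(x - y \in submod_pred N) Quotient.idealrBE.
by split => /eqP.
Qed.

Lemma quot_mod_piD x y :
  quot_mod_pi (x + y) = quot_mod_pi x + quot_mod_pi y.
Proof.
exact: (@raddfD _ _ (\pi_(Quotient.quot (submod_pred N)) : {additive M -> Quotient.quot (submod_pred N)})).
Qed.

Lemma quot_mod_piZ r x : quot_mod_scale r (quot_mod_pi x) = quot_mod_pi (r *: x).
Proof.
apply/quot_mod_pi_eq; rewrite -scalerBr rpredZ //; apply/quot_mod_pi_eq.
by rewrite /quot_mod_pi reprK.
Qed.

Lemma quot_mod_piP (u : quot_mod N) : exists x, u = quot_mod_pi x.
Proof. by exists (repr (u : Quotient.quot (submod_pred N))); rewrite /quot_mod_pi reprK. Qed.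

Lemma quot_mod_scaleA r s u :
  quot_mod_scale r (quot_mod_scale s u) = quot_mod_scale (r * s) u.
Proof. by have [x ->] := quot_mod_piP u; rewrite !quot_mod_piZ scalerA. Qed.

Lemma quot_mod_scale1 : left_id 1 quot_mod_scale.
Proof. by move=> u; have [x ->] := quot_mod_piP u; rewrite quot_mod_piZ scale1r. Qed.

Lemma quot_mod_scaleDr : right_distributive quot_mod_scale +%R.
Proof.
move=> r u v; have [x ->] := quot_mod_piP u; have [y ->] := quot_mod_piP v.
by rewrite -quot_mod_piD !quot_mod_piZ scalerDr quot_mod_piD.
Qed.

Lemma quot_mod_scaleDl u : {morph quot_mod_scale^~ u : r s / r + s}.
Proof.
move=> r s; have [x ->] := quot_mod_piP u.
by rewrite !quot_mod_piZ scalerDl quot_mod_piD.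
Qed.

HB.instance Definition _ := GRing.Zmodule_isLmodule.Build R (quot_mod N)
  quot_mod_scaleA quot_mod_scale1 quot_mod_scaleDr quot_mod_scaleDl.

End Quotient.

Definition generates (P : {pred M}) n (g : 'I_n -> M) : Prop :=
  forall x, x \in P <-> exists c : 'I_n -> R, x = \sum_i c i *: g i.

Definition finitely_generated (P : {pred M}) : Prop :=
  exists n (g : 'I_n -> M), generates P g.

End Submodules.

Definition noetherian (R : comPzRingType) : Prop :=
  forall I : ideal R, finitely_generated I.

Section Spectrum.
Variable R : comPzRingType.

Definition prime_ideal (p : ideal R) : Prop :=
  1 \notin p /\ forall u v : R, u * v \in p -> u \in p \/ v \in p.

Definition prime_chain n (p : 'I_n.+1 -> ideal R) : Prop :=
  (forall i, prime_ideal (p i)) /\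
  (forall i j : 'I_n.+1, (i < j)%N ->
    {subset p i <= p j} /\ ~ {subset p j <= p i}).

Definition krull_dim : \bar int :=
  supremum -oo%E [set (n%:Z)%:E | n in [set n | exists p, @prime_chain n p]].

(* m / s = n / t in the localization of M at p *)
Definition frac_eq (M : lmodType R) (p : ideal R) (m : M) (s : R) (n : M) (t : R)
    : Prop :=
  exists2 u : R, u \notin p & u *: (t *: m - s *: n) = 0.

(* the localization of M at p has an element m / s other than 0 / 1 *)
Definition localization_neq0 (M : lmodType R) (p : ideal R) : Prop :=
  exists m : M, exists2 s : R, s \notin p & ~ frac_eq p m s 0 1.

Definition module_support (M : lmodType R) : set (ideal R) :=
  [set p | prime_ideal p /\ localization_neq0 M p].

Definition minimal_in (S : set (ideal R)) (p : ideal R) : Prop :=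
  S p /\ forall q, S q -> {subset q <= p} -> {subset p <= q}.

End Spectrum.

Section Complexes.
Variable R : comPzRingType.

Record cochain_complex := CochainComplex {
  cochain :> nat -> lmodType R;
  differential : forall n, {linear cochain n -> cochain n.+1};
  differentialK : forall n x, differential n.+1 (differential n x) = 0
}.

Section Cohomology.
Variables (C : cochain_complex) (n : nat).

Definition cocycle : {pred C n} := [pred x | differential C n x == 0].

Lemma cocycle_submod_closed : submod_closed cocycle.
Proof.
split=> [|r x y]; rewrite !inE ?linear0 // => /eqP dx /eqP dy.
by rewrite linearP dx dy scaler0 addr0.
Qed.

HB.instance Definition _ :=
  GRing.isSubmodClosed.Build R (C n) cocycle cocycle_submod_closed.

End Cohomology.

(* the complex is extended by zero in negative degrees *)
Definition is_coboundary (C : cochain_complex) n : C n -> Prop :=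
  match n with
  | 0%N => fun x => x = 0
  | m.+1 => fun x => exists y, differential C m y = x
  end.

Section Cohomology.
Variables (C : cochain_complex) (n : nat).

Definition coboundary : {pred submod_type (@cocycle C n)} :=
  [pred x | `[< is_coboundary (val x) >]].

Lemma coboundary_submod_closed : submod_closed coboundary.
Proof.
rewrite /coboundary; case: n => [|m]; split=> [|r x y].
- exact/asboolP.
- move=> /asboolP/= x0 /asboolP/= y0; apply/asboolP => /=.
  by rewrite x0 y0 scaler0 addr0.
- by apply/asboolP; exists 0; rewrite linear0.
- move=> /asboolP[u ux] /asboolP[v vy]; apply/asboolP => /=.
  by exists (r *: u + v); rewrite linearP ux vy.
Qed.

HB.instance Definition _ :=
  GRing.isSubmodClosed.Build R (submod_type (@cocycle C n)) coboundary
    coboundary_submod_closed.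

Definition cohomology : lmodType R := quot_mod coboundary.

End Cohomology.

Definition injective_module (E : lmodType R) : Prop :=
  forall (A B : lmodType R) (f : {linear A -> B}) (g : {linear A -> E}),
    injective f -> exists h : {linear B -> E}, forall x, h (f x) = g x.

Record injective_resolution (M : lmodType R) := InjectiveResolution {
  resolution :> cochain_complex;
  augmentation : {linear M -> resolution 0%N};
  resolution_injective : forall n, injective_module (resolution n);
  augmentation_inj : injective augmentation;
  augmentation_exact : forall x,
    differential resolution 0 x = 0 <-> exists m, augmentation m = x;
  resolution_exact : forall n x,
    differential resolution n.+1 x = 0 -> exists y, differential resolution n y = x
}.

End Complexes.

Section LocalCohomology.
Variables (R : comPzRingType) (a : ideal R).

Definition ideal_mul (I J : set R) : set R :=
  [set x | exists n (f g : 'I_n -> R),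
    (forall i, I (f i) /\ J (g i)) /\ x = \sum_i f i * g i].

Fixpoint ideal_exp n : set R :=
  if n is m.+1 then ideal_mul [set x | x \in a] (ideal_exp m) else setT.

Lemma ideal_expS n : ideal_exp n.+1 `<=` ideal_exp n.
Proof.
elim: n => [//|n IHn] x [k [f [g [fg ->]]]]; exists k, f, g; split=> // i.
by have [? /IHn] := fg i.
Qed.

Lemma ideal_expD m n : ideal_exp (m + n) `<=` ideal_exp n.
Proof. by elim: m => [//|m IHm] x /ideal_expS/IHm. Qed.

Definition torsion (M : lmodType R) : {pred M} :=
  [pred x | `[< exists n, forall r, ideal_exp n r -> r *: x = 0 >]].

Section Torsion.
Variable M : lmodType R.

Lemma torsion_submod_closed : submod_closed (@torsion M).
Proof.
split=> [|r x y].
  by apply/asboolP; exists 0%N => r _; rewrite scaler0.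
move=> /asboolP[m xm] /asboolP[n yn]; apply/asboolP; exists (m + n)%N => s as_.
rewrite scalerDr scalerA mulrC -scalerA yn ?addr0; last exact: ideal_expD as_.
by rewrite xm ?scaler0 //; apply: (@ideal_expD n); rewrite addnC.
Qed.

HB.instance Definition _ :=
  GRing.isSubmodClosed.Build R M (@torsion M) torsion_submod_closed.

Definition torsion_functor : lmodType R := submod_type (@torsion M).

End Torsion.

Section TorsionMap.
Variables (M N : lmodType R) (f : {linear M -> N}).

Lemma torsion_map_subproof (x : torsion_functor M) : f (val x) \in @torsion N.
Proof.
case: x => x /= /asboolP[n xn]; apply/asboolP; exists n => r ar.
by rewrite -linearZ_LR xn ?linear0.
Qed.

Definition torsion_map (x : torsion_functor M) : torsion_functor N :=
  Sub (f (val x)) (torsion_map_subproof x).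

Lemma torsion_map_linear : linear torsion_map.
Proof. by move=> r x y; apply: val_inj; rewrite /= !linearP. Qed.

HB.instance Definition _ :=
  GRing.isLinear.Build R (torsion_functor M) (torsion_functor N) *:%R
    torsion_map torsion_map_linear.

End TorsionMap.

Lemma torsion_complex_subproof (C : cochain_complex R) n
    (x : torsion_functor (C n)) :
  torsion_map (differential C n.+1) (torsion_map (differential C n) x) = 0.
Proof. by apply: val_inj; rewrite /= differentialK. Qed.

Definition torsion_complex (C : cochain_complex R) : cochain_complex R :=
  @CochainComplex R (fun n => torsion_functor (C n))
    (fun n => torsion_map (differential C n)) (@torsion_complex_subproof C).

(* The i-th right derived functor of the a-torsion functor at M, computed     *)
(* from an injective resolution I of M: every module has one, and the result    *)
(* does not depend on I up to isomorphism                                     *)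
Definition local_cohomology (M : lmodType R) (I : injective_resolution M) i
    : lmodType R :=
  cohomology (torsion_complex I) i.

Definition local_cohomology_neq0 (M : lmodType R) i : Prop :=
  exists I : injective_resolution M, exists x : local_cohomology I i, x != 0.

Definition cd (M : lmodType R) : \bar int :=
  supremum -oo%E [set (i%:Z)%:E | i in [set i | local_cohomology_neq0 M i]].

End LocalCohomology.

(* Main.v *)
Require Import Defs.
From HB Require Import structures.
From mathcomp Require Import all_boot all_order all_algebra.
From mathcomp Require Import boolp classical_sets functions constructive_ereal.

(** Write V(i, M) for the vanishing of the i-th local cohomology of M.  Three
facts are used: V is compatible with short exact sequences; over a noetherian
ring V(i, N) for all finitely generated submodules N of M gives V(i, M); and
V(i, N) for a finitely generated N follows from V(i, R/q) for all q in its
support, because a maximal submodule with vanishing H^i can be enlarged by a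
copy of some R/q as long as it is proper ([vanishes_of_support]).

The inequality is the contrapositive of the last two facts: if H^c(M) is not
zero for c = cd(a, M), then H^c(R/p) is not zero for some p in Supp M.

For the equality let M be finitely generated and suppose V(i, M) for all
i >= k.  Then V(i, R/p) for all i >= k and all p in Supp M
([vanishes_quotients_of_support]), by descending induction on i and, for fixed
i, by noetherian induction on p.  Indeed some linear map M -> R/p is not zero
([nonzero_map_to_quotient]).  Let K be its kernel and J its image: V(i+1, K)
holds by descending induction, so V(i, J) holds, while the cokernel is
supported at primes strictly above p; hence V(i, R/p).  The descending
induction starts at the Krull dimension, by Grothendieck vanishing for the R/p
([vanishes_above_dim]).  The lemma is applied twice.  For M it gives
cd(a, R/q) <= c for every q in Supp M.  For R/q, with q minimal in Supp M below
the prime p of the inequality, it gives H^c(R/q) <> 0: otherwise H^c(R/p) would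
vanish, as p is in Supp(R/q).

The rest is the homological algebra behind V.  Injective resolutions exist
because R-modules embed into modules of additive maps from R to powers of Q/Z;
over a noetherian ring the a-torsion part of an injective module is injective,
so that torsion modules have torsion resolutions and no higher local
cohomology.  Comparison maps, homotopies and the horseshoe construction all
come from one extension property of injective modules
([injective_extend_along]), and the pieces of the long exact sequence are read
off the horseshoe resolution elementwise. *)

Set Implicit Arguments.
Unset Strict Implicit.
Unset Printing Implicit Defensive.

Import Order.TTheory GRing.Theory Num.Theory.

Local Open Scope ring_scope.

(** * Submodules and linear maps *)

Section Linear.
Variable R : comPzRingType.
Implicit Types A B C M : lmodType R.

Section LinearOf.
Variables (A B : lmodType R) (f : A -> B) (Hf : linear f).
(** The proof is kept as an argument so that the linear structure can be inferred
from the head of the term. *)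
Definition linear_fun of linear f := f.
HB.instance Definition _ := GRing.isLinear.Build R A B *:%R (linear_fun Hf) Hf.
Definition linear_of : {linear A -> B} := linear_fun Hf.
End LinearOf.

Definition is_submodule M (P : M -> Prop) : Prop :=
  P 0 /\ forall r x y, P x -> P y -> P (r *: x + y).

Section SubmoduleOf.
Variables (M : lmodType R) (P : M -> Prop) (HP : is_submodule P).
Definition submodule_pred of is_submodule P : {pred M} := [pred x | `[< P x >]].
Lemma submodule_pred_closed : submod_closed (submodule_pred HP).
Proof.
case: HP => P0 PD; split; first exact/asboolP.
by move=> r x y /asboolP Px /asboolP Py; apply/asboolP/PD.
Qed.
HB.instance Definition _ :=
  GRing.isSubmodClosed.Build R M (submodule_pred HP) submodule_pred_closed.
Definition submodule_of : submodClosed M := submodule_pred HP.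
Lemma submodule_ofP x : x \in submodule_of <-> P x.
Proof. by split=> /asboolP. Qed.
End SubmoduleOf.

Lemma submodule_is M (N : submodClosed M) : is_submodule (fun x => x \in N).
Proof. by split=> [|r x y xN yN]; rewrite ?rpred0 ?rpredD ?rpredZ. Qed.

Lemma submoduleB M (N : submodClosed M) x y : x \in N -> y \in N -> x - y \in N.
Proof. by move=> xN yN; rewrite rpredD // -scaleN1r rpredZ. Qed.

Lemma submoduleN M (N : submodClosed M) x : x \in N -> - x \in N.
Proof. by move=> xN; rewrite -scaleN1r rpredZ. Qed.

Section KernelImage.
Variables (A B : lmodType R) (f : {linear A -> B}).
Lemma is_submodule_kernel : is_submodule (fun x => f x = 0).
Proof. by split=> [|r x y fx fy]; rewrite ?linear0 // linearP fx fy scaler0 addr0. Qed.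
Definition kernel := submodule_of is_submodule_kernel.
Lemma kernelP x : x \in kernel <-> f x = 0.
Proof. exact: submodule_ofP. Qed.
Lemma is_submodule_image (N : submodClosed A) :
  is_submodule (fun y => exists2 x, x \in N & f x = y).
Proof.
split=> [|r x y [u uN <-] [v vN <-]]; first by exists 0; rewrite ?linear0 ?rpred0.
by exists (r *: u + v); rewrite ?linearP // rpredD ?rpredZ.
Qed.
Definition image_of N := submodule_of (is_submodule_image N).
Lemma image_ofP N y : y \in image_of N <-> exists2 x, x \in N & f x = y.
Proof. exact: submodule_ofP. Qed.
Lemma is_submodule_preimage (N : submodClosed B) : is_submodule (fun x => f x \in N).
Proof.
by split=> [|r x y fx fy]; rewrite ?linear0 ?rpred0 // linearP rpredD ?rpredZ.
Qed.
Definition preimage_of N := submodule_of (is_submodule_preimage N).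
Lemma preimage_ofP N x : x \in preimage_of N <-> f x \in N.
Proof. exact: submodule_ofP. Qed.
End KernelImage.

Section Inclusion.
Variables (M : lmodType R) (N : submodClosed M).
Lemma linear_incl : linear (fun x : submod_type N => val x).
Proof. by move=> r x y; rewrite linearP. Qed.
Definition sub_incl : {linear submod_type N -> M} := linear_of linear_incl.
Lemma sub_incl_inj : injective sub_incl.
Proof. exact: val_inj. Qed.
Lemma sub_incl_in x : sub_incl x \in N.
Proof. exact: valP. Qed.
Lemma sub_inclP y : y \in N <-> exists x, sub_incl x = y.
Proof.
split=> [yN|[x <-]]; last exact: sub_incl_in.
by exists (Sub y yN : submod_type N); rewrite /= /linear_fun SubK.
Qed.

Section Corestrict.
Variables (A : lmodType R) (f : {linear A -> M}) (fN : forall x, f x \in N).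
Lemma linear_corestrict : linear (fun x : A => Sub (f x) (fN x) : submod_type N).
Proof. by move=> r x y; apply: val_inj; rewrite /= linearP. Qed.
Definition corestrict : {linear A -> submod_type N} := linear_of linear_corestrict.
Lemma corestrictK x : sub_incl (corestrict x) = f x.
Proof. by []. Qed.
End Corestrict.

Lemma linear_quot : linear (@quot_mod_pi R M N).
Proof. by move=> r x y; rewrite quot_mod_piD -quot_mod_piZ. Qed.
Definition quot_proj : {linear M -> quot_mod N} := linear_of linear_quot.
Lemma quot_proj_surj u : exists x, quot_proj x = u.
Proof. by have [x ->] := quot_mod_piP u; exists x. Qed.
Lemma quot_proj_eq0 x : quot_proj x = 0 <-> x \in N.
Proof.
rewrite -(linear0 quot_proj) -[X in X \in N]subr0.
exact: (quot_mod_pi_eq N x 0).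
Qed.
End Inclusion.

Lemma factor_surj A B C (g : {linear A -> B}) (v : {linear A -> C}) :
  (forall y, exists x, g x = y) -> (forall x, g x = 0 -> v x = 0) ->
  exists h : {linear B -> C}, forall x, h (g x) = v x.
Proof.
move=> gs gv; have [s sK] := choice gs.
have vE x y : g x = g y -> v x = v y.
  by move=> gxy; apply/subr0_eq; rewrite -linearB gv // linearB gxy subrr.
have lin : linear (v \o s).
  move=> r x y; rewrite /= -linearP; apply: vE.
  by rewrite sK linearP !sK.
by exists (linear_of lin) => x; apply: vE; rewrite sK.
Qed.

Lemma factor_inj A B M (u : {linear M -> B}) (v : {linear A -> B}) :
  injective u -> (forall x, exists m, u m = v x) ->
  exists h : {linear A -> M}, forall x, u (h x) = v x.
Proof.
move=> ui /choice[h hP].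
have lin : linear h by move=> r x y; apply: ui; rewrite linearP !hP linearP.
by exists (linear_of lin).
Qed.

Definition short_exact A B C (f : {linear A -> B}) (g : {linear B -> C}) : Prop :=
  [/\ injective f, forall c, exists b, g b = c
    & forall b, g b = 0 <-> exists a, f a = b].

Lemma short_exact_quot M (N : submodClosed M) : short_exact (sub_incl N) (quot_proj N).
Proof.
split; [exact: sub_incl_inj | exact: quot_proj_surj |] => b.
by rewrite quot_proj_eq0 sub_inclP.
Qed.

Lemma is_submodule_zero M : is_submodule (fun x : M => x = 0).
Proof. by split=> [|r x y -> ->]; rewrite ?scaler0 ?addr0. Qed.
Definition zero_submodule M := submodule_of (is_submodule_zero M).
Lemma zero_submoduleP M (x : M) : x \in zero_submodule M <-> x = 0.
Proof. exact: submodule_ofP. Qed.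

Lemma is_submodule_full M : is_submodule (fun _ : M => True).
Proof. by []. Qed.
Definition full_submodule M := submodule_of (is_submodule_full M).
Lemma full_submoduleP M x : x \in full_submodule M.
Proof. exact/submodule_ofP. Qed.

Lemma short_exact_coker A B (f : {linear A -> B}) :
  injective f -> short_exact f (quot_proj (image_of f (full_submodule A))).
Proof.
move=> fi; split=> // [|b]; first exact: quot_proj_surj.
rewrite quot_proj_eq0 image_ofP; split=> [[x _ <-]|[x <-]]; first by exists x.
by exists x => //; apply: full_submoduleP.
Qed.

Lemma short_exact_surj A B (g : {linear A -> B}) :
  (forall y, exists x, g x = y) -> short_exact (sub_incl (kernel g)) g.
Proof.
by move=> gs; split=> [||b]; [apply: sub_incl_inj | | rewrite -kernelP sub_inclP].
Qed.

Section Multiplication.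
Variables (M : lmodType R).
Lemma linear_scale (r : R) : linear (fun x : M => r *: x).
Proof. by move=> s x y; rewrite scalerDr !scalerA mulrC. Qed.
Definition scale_by r : {linear M -> M} := linear_of (linear_scale r).
Lemma scale_byE r x : scale_by r x = r *: x.
Proof. by []. Qed.
Lemma linear_generate (x : M) : linear (fun r : R^o => r *: x).
Proof. by move=> r s y; rewrite scalerDl scalerA. Qed.
Definition generate x : {linear R^o -> M} := linear_of (linear_generate x).
Lemma generateE x (r : R) : generate x r = r *: x.
Proof. by []. Qed.
End Multiplication.

(** * Noetherian modules *)

Definition noetherian_module M : Prop :=
  forall N : submodClosed M, finitely_generated N.

Lemma generates_mem M (N : {pred M}) n (g : 'I_n -> M) i : generates N g -> g i \in N.
Proof.
move=> gP; apply/gP; exists (fun j => (j == i)%:R).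
rewrite (bigD1 i) //= eqxx scale1r big1 ?addr0 // => j /negPf ->.
by rewrite scale0r.
Qed.

Lemma noetherian_surj A B (g : {linear A -> B}) :
  (forall y, exists x, g x = y) -> noetherian_module A -> noetherian_module B.
Proof.
move=> gs noeA N; have [n [e eP]] := noeA (preimage_of g N).
exists n, (g \o e) => y; split=> [yN|[c ->]].
  have [x xy] := gs y; have /eP[c xc] : x \in preimage_of g N.
    by apply/preimage_ofP; rewrite xy.
  by exists c; rewrite -xy xc linear_sum; apply: eq_bigr => i _; rewrite linearZ.
have /preimage_ofP : \sum_i c i *: e i \in preimage_of g N by apply/eP; exists c.
by rewrite linear_sum; under eq_bigr do rewrite linearZ.
Qed.

Lemma noetherian_inj A B (f : {linear A -> B}) :
  injective f -> noetherian_module B -> noetherian_module A.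
Proof.
move=> fi noeB N; have [n [e eP]] := noeB (image_of f N).
have /choice[d dP] i : exists x, x \in N /\ f x = e i.
  have /image_ofP[x xN fx] : e i \in image_of f N.
    exact: generates_mem eP.
  by exists x.
exists n, d => x; split=> [xN|[c ->]]; last first.
  by apply: rpred_sum => i _; rewrite rpredZ //; case: (dP i).
have /eP[c xc] : f x \in image_of f N by apply/image_ofP; exists x.
exists c; apply: fi; rewrite xc linear_sum; apply: eq_bigr => i _.
by rewrite linearZ; case: (dP i) => _ ->.
Qed.

(** Generators of the trace of N on A, together with lifts of generators of its
image in C, generate N. *)
Lemma noetherian_ext A B C (f : {linear A -> B}) (g : {linear B -> C}) :
  short_exact f g -> noetherian_module A -> noetherian_module C ->
  noetherian_module B.
Proof.
move=> [fi gs fg] noeA noeC N.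
have [m [a aP]] := noeA (preimage_of f N).
have [n [e eP]] := noeC (image_of g N).
have /choice[b bP] i : exists x, x \in N /\ g x = e i.
  have /image_ofP[x xN gx] : e i \in image_of g N.
    exact: generates_mem eP.
  by exists x.
have faN i : f (a i) \in N.
  exact/preimage_ofP/(generates_mem _ aP).
exists (m + n)%N, (fun k => match fintype.split k with inl i => f (a i) | inr j => b j end).
move=> x; split=> [xN|[c ->]]; last first.
  apply: rpred_sum => k _; rewrite rpredZ //; case: (fintype.split k) => // j.
  by case: (bP j).
have /eP[c gx] : g x \in image_of g N by apply/image_ofP; exists x.
have bN : \sum_i c i *: b i \in N.
  by apply: rpred_sum => i _; rewrite rpredZ //; case: (bP i).
have /fg[y fy] : g (x - \sum_i c i *: b i) = 0.
  rewrite linearB linear_sum gx -sumrB big1 // => i _.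
  by rewrite linearZ; case: (bP i) => _ ->; rewrite subrr.
have /aP[d yd] : y \in preimage_of f N.
  by apply/preimage_ofP; rewrite fy submoduleB.
exists (fun k => match fintype.split k with inl i => d i | inr j => c j end).
rewrite big_split_ord /=.
under eq_bigr => i _ do rewrite (unsplitK (inl i)).
under [X in _ + X]eq_bigr => i _ do rewrite (unsplitK (inr i)).
rewrite -[LHS](subrK (\sum_i c i *: b i)); congr (_ + _).
rewrite -fy yd linear_sum.
by apply: eq_bigr => i _; rewrite linearZ.
Qed.

(** Induction on the number of generators: a module generated by n + 1 elements
is an extension of one generated by n elements by a cyclic module. *)
Lemma noetherian_fg M : noetherian R ->
  finitely_generated (predT : {pred M}) -> noetherian_module M.
Proof.
move=> noeR [n [g gP]].
have {gP}: forall x : M, exists c : 'I_n -> R, x = \sum_i c i *: g i.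
  by move=> x; apply/gP.
elim: n M g => [|n IHn] M g gP.
  move=> N; exists 0%N, (fun=> 0) => x; split=> [_|[c ->]]; last first.
    by rewrite big_ord0 rpred0.
  exists (fun=> 0); rewrite big_ord0.
  by have [c ->] := gP x; rewrite big_ord0.
have H := short_exact_quot (image_of (generate (g ord0)) (full_submodule _)).
apply: (noetherian_ext H).
  have lin r : generate (g ord0) r \in image_of (generate (g ord0)) (full_submodule _).
    by apply/image_ofP; exists r => //; apply: full_submoduleP.
  apply: (@noetherian_surj _ _ (corestrict lin)) => // y.
  have /image_ofP[r _ ry] := sub_incl_in y.
  by exists r; apply: sub_incl_inj.
apply: (IHn _ (fun i => quot_proj _ (g (lift ord0 i)))) => y.
have [x <-] := quot_proj_surj y; have [c ->] := gP x.
exists (fun i => c (lift ord0 i)).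
rewrite big_ord_recl linearD linear_sum.
have /quot_proj_eq0 -> : c ord0 *: g ord0 \in
    image_of (generate (g ord0)) (full_submodule _).
  by apply/image_ofP; exists (c ord0) => //; apply: full_submoduleP.
by rewrite add0r; apply: eq_bigr => i _; rewrite linearZ.
Qed.

Lemma noetherian_module_fg M : noetherian_module M ->
  finitely_generated (predT : {pred M}).
Proof.
move=> /(_ (full_submodule M))[n [g gP]]; exists n, g => x.
by split=> // _; apply/gP/full_submoduleP.
Qed.

(** A family without maximal element contains a strictly increasing sequence; the
union of that sequence is finitely generated, hence equal to one of its
members. *)
Lemma noetherian_max M (F : submodClosed M -> Prop) (N0 : submodClosed M) :
  noetherian_module M -> F N0 ->
  exists N : submodClosed M, F N /\
    forall N' : submodClosed M, F N' -> {subset N <= N'} -> {subset N' <= N}.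
Proof.
move=> noeM FN0; apply: contrapT => /forallNP nomax.
have /choice[s sP] (N : {N | F N}) :
    exists N' : {N | F N}, {subset sval N <= sval N'} /\
      ~ {subset sval N' <= sval N}.
  case: N => N FN /=; have /not_andP[//|/existsNP[N']] := nomax N.
  move=> /not_implyP[FN'] /not_implyP[NN' nN'N].
  by exists (exist _ N' FN').
pose N k := sval (iter k s (exist _ N0 FN0)).
have Nle k l : (k <= l)%N -> {subset N k <= N l}.
  move=> /subnKC <-; elim: (l - k)%N => [|j IHj]; first by rewrite addn0.
  move=> x /IHj xN; rewrite addnS /N iterS.
  by have [+ _] := sP (iter (k + j) s (exist _ N0 FN0)); apply.
have unionP : is_submodule (fun x => exists k, x \in N k).
  split=> [|r x y [k xk] [l yl]]; first by exists 0%N; rewrite rpred0.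
  exists (maxn k l); rewrite rpredD ?rpredZ //.
    by apply: Nle xk; apply: leq_maxl.
  by apply: Nle yl; apply: leq_maxr.
have [n [g gP]] := noeM (submodule_of unionP).
have /choice[k kP] i : exists k, g i \in N k.
  exact/(submodule_ofP unionP)/(generates_mem _ gP).
(* All generators of the union lie in N K, so N K.+1 is not strictly larger. *)
pose K := (\max_i k i)%N.
case: (sP (iter K s (exist _ N0 FN0))) => _; apply=> x xK.
have /gP[c ->] : x \in submodule_of unionP.
  by apply/submodule_ofP; exists K.+1.
apply: rpred_sum => i _; rewrite rpredZ //.
by apply: Nle (kP i); apply: (leq_bigmax i).
Qed.

End Linear.

(** * Injective modules *)

Section Injective.
Variable R : comPzRingType.
Implicit Types A B C E M : lmodType R.

(** A linear map defined on a submodule of B is encoded by its graph G, a submodule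
of B * E containing no (0, e) with e <> 0. *)
Definition extends_partial_maps E : Prop :=
  forall B (G : submodClosed (B * E)%type), (forall e, (0, e) \in G -> e = 0) ->
  exists h : {linear B -> E}, forall b e, (b, e) \in G -> h b = e.

(** A partial linear map on I is represented by a total function that is linear on
I. *)
Definition baer E : Prop := forall (I : ideal R) (f : R -> E),
  (forall r x y, x \in I -> y \in I -> f (r * x + y) = r *: f x + f y) ->
  exists e, forall x, x \in I -> f x = x *: e.

Lemma extends_injective E : extends_partial_maps E -> injective_module E.
Proof.
move=> extE A B f g fi.
have HG : is_submodule (fun be : B * E => exists a, be = (f a, g a)).
  split=> [|r _ _ [a ->] [a' ->]]; first by exists 0; rewrite !linear0.
  by exists (r *: a + a'); rewrite !linearP.
have [e /submodule_ofP[a [fa ->]]|h hP] := extE B (submodule_of HG).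
  have -> : a = 0 by apply: fi; rewrite -fa linear0.
  by rewrite linear0.
by exists h => a; apply/hP/submodule_ofP; exists a.
Qed.

(** The graph embeds into B by its first projection, and its second projection
is the map to be extended. *)
Lemma injective_extends E : injective_module E -> extends_partial_maps E.
Proof.
move=> injE B G G0.
have l1 : linear (fun x : submod_type G => (sub_incl G x).1).
  by move=> r x y; rewrite (linearP (sub_incl G)).
have l2 : linear (fun x : submod_type G => (sub_incl G x).2).
  by move=> r x y; rewrite (linearP (sub_incl G)).
have inj1 : injective (linear_of l1).
  move=> x y xy; apply/subr0_eq/sub_incl_inj; rewrite linear0.
  have := sub_incl_in (x - y); have : (sub_incl G (x - y)).1 = 0.
    by transitivity (linear_of l1 (x - y)); rewrite // linearB xy subrr.
  by case: (sub_incl G (x - y)) => b e /= -> /G0 ->.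
have [h hP] := injE _ _ (linear_of l1) (linear_of l2) inj1.
exists h => b e /sub_inclP[x xbe].
have -> : b = linear_of l1 x by transitivity (sub_incl G x).1; [rewrite xbe|].
by rewrite hP; transitivity (sub_incl G x).2; [|rewrite xbe].
Qed.

(** The form in which injectivity is applied throughout: u need not be injective,
because v factors through the image of u. *)
Lemma injective_extend_along A B E (u : {linear A -> B}) (v : {linear A -> E}) :
  injective_module E -> (forall x, u x = 0 -> v x = 0) ->
  exists h : {linear B -> E}, forall x, h (u x) = v x.
Proof.
move=> /injective_extends extE uv.
have HG : is_submodule (fun be : B * E => exists a, be = (u a, v a)).
  split=> [|r _ _ [a ->] [a' ->]]; first by exists 0; rewrite !linear0.
  by exists (r *: a + a'); rewrite !linearP.
have [e /submodule_ofP[a [ua ->]]|h hP] := extE B (submodule_of HG).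
  exact: uv.
by exists h => a; apply/hP/submodule_ofP; exists a.
Qed.

(** Baer's criterion.  A maximal functional graph X above G is everywhere defined:
for b outside its domain, the elements r with r b in the domain form an ideal,
the linear map on it given by X has the form r |-> r e, and (b, e) can be
added to X. *)
Lemma baer_extends E : baer E -> extends_partial_maps E.
Proof.
move=> baerE B G G0.
(* The empty graph is admitted because it is the union of the empty chain. *)
pose good (X : set (B * E)) := [/\ is_submodule X,
  forall e, X (0, e) -> e = 0 & forall be, be \in G -> X be].
have goodG : good (fun be => be \in G) by split=> //; apply: submodule_is.
have [|X [[X0|[Xsub X0 GX]] Xmax]] :=
  @Zorn_bigcup (B * E)%type [set X | X = set0 \/ good X].
- move=> F FP Ftot; have [[X0 [FX0 goodX0]]|noX] := pselect (exists X, F X /\ good X).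
    have Fgood X be : F X -> X be -> good X.
      by move=> /FP[->|] //.
    right; split=> [|e [X FX Xe]|be Gbe].
    + split=> [|r x y [X FX Xx] [Y FY Yy]].
        by exists X0 => //; case: goodX0 => -[].
      have [/(_ _ Xx) Yx|/(_ _ Yy) Xy] := Ftot _ _ FX FY.
        by exists Y => //; have [[_ +] _ _] := Fgood _ _ FY Yy; apply.
      by exists X => //; have [[_ +] _ _] := Fgood _ _ FX Xx; apply.
    + by have [_ + _] := Fgood _ _ FX Xe; apply.
    + by exists X0 => //; have [_ _] := goodX0; apply.
  left; apply/seteqP; split=> // x [X FX Xx]; case: noX; exists X; split=> //.
  by have [X0|//] := FP _ FX; rewrite X0 in Xx.
- case: (Xmax (fun be => be \in G)); last by right.
  rewrite X0; split=> // /(_ 0); apply.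
  exact: (rpred0 G).
- have Xuniq b e e' : X (b, e) -> X (b, e') -> e = e'.
    move=> Xe Xe'; apply/subr0_eq/X0.
    have := Xsub.2 (-1) _ _ Xe' Xe.
    by rewrite scaleN1r [- _ + _]addrC /GRing.add /= /add_pair /= subrr.
  have Xtot b : exists e, X (b, e).
    have HI : is_submodule (fun r : R^o => exists e, X ((r : R) *: b, e)).
      split=> [|r x y [e Xe] [e' Xe']].
        by exists 0; rewrite scale0r; exact: Xsub.1.
      exists (r *: e + e'); have := Xsub.2 r _ _ Xe Xe'.
      by rewrite -[_ + _]/(_, _) /= scalerA -scalerDl.
    have /choice[f fP] (r : R) : exists e, (exists e, X (r *: b, e)) -> X (r *: b, e).
      by have [[e]|] := pselect (exists e, X (r *: b, e)); [exists e | exists 0].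
    have [r x y /submodule_ofP Ix /submodule_ofP Iy|e eP] :=
        baerE (submodule_of HI) f.
      apply: (Xuniq ((r * x + y) *: b)).
        by apply: fP; apply: HI.2.
      have := Xsub.2 r _ _ (fP _ Ix) (fP _ Iy).
      by rewrite -[_ + _]/(_, _) /= scalerA -scalerDl.
    apply: contrapT => /forallNP bX.
    pose Y : set (B * E) := fun be => exists x r, X x /\ be = x + r *: (b, e).
    case: (Xmax Y).
      split=> [|YX]; first by move=> x Xx; exists x, 0; rewrite scale0r addr0.
      apply: (bX e); apply: YX; exists 0, 1; rewrite scale1r add0r.
      by split=> //; exact: Xsub.1.
    right; split.
    - split=> [|r _ _ [x [s [Xx ->]]] [y [t [Xy ->]]]].
        by exists 0, 0; rewrite scale0r addr0; split=> //; exact: Xsub.1.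
      exists (r *: x + y), (r * s + t); split; first exact: Xsub.2.
      by rewrite scalerDr scalerDl scalerA addrACA.
    - move=> e' [[x1 x2] [r [Xx]]].
      rewrite -[_ + _]/(_, _) /= => -[/esym/eqP x1r ->].
      move: x1r; rewrite addrC addr_eq0 => /eqP rb.
      have Xr : X (r *: b, - x2).
        have := Xsub.2 (-1) _ _ Xx Xsub.1.
        by rewrite addr0 rb -[_ *: _]/(_, _) /= !scaleN1r.
      have rI := (submodule_ofP HI r).2 (ex_intro _ (- x2) Xr).
      have Xf : X (r *: b, f r) by apply: fP; exists (- x2).
      by rewrite -(eP r rI) -(Xuniq _ _ _ Xr Xf) subrr.
    - by move=> be /GX Xbe; exists be, 0; rewrite scale0r addr0.
  have [h hP] := choice Xtot.
  have lin : linear h.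
    move=> r x y; apply: (Xuniq (r *: x + y)); first exact: hP.
    exact: Xsub.2 (hP x) (hP y).
  exists (linear_of lin) => b e Gbe; apply: Xuniq (hP b) _; exact: GX.
Qed.

Lemma baer_injective E : baer E -> injective_module E.
Proof. by move=> /baer_extends/extends_injective. Qed.

Lemma injective_prod A B :
  injective_module A -> injective_module B -> injective_module (A * B)%type.
Proof.
move=> injA injB X Y f g fi.
have l1 : linear (fun x => (g x).1) by move=> r x y; rewrite linearP.
have l2 : linear (fun x => (g x).2) by move=> r x y; rewrite linearP.
have [h1 h1P] := injA _ _ f (linear_of l1) fi.
have [h2 h2P] := injB _ _ f (linear_of l2) fi.
have lin : linear (fun y => (h1 y, h2 y)).
  by move=> r x y; rewrite !linearP.
exists (linear_of lin) => x; rewrite /= /linear_fun h1P h2P.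
by rewrite [RHS]surjective_pairing.
Qed.

End Injective.

(** * Enough injectives *)

Section RationalsModIntegers.

Lemma is_submodule_int : is_submodule (fun x : zmodule rat => (x : rat) \is a Num.int).
Proof. by split=> [|r x y xZ yZ]; rewrite ?rpred0 // rpredD // scalezrE rpredMz. Qed.

Definition rat_mod_int : lmodType int := quot_mod (submodule_of is_submodule_int).

Definition to_rat_mod_int : {linear zmodule rat -> rat_mod_int} :=
  quot_proj (submodule_of is_submodule_int).

Lemma rat_mod_int_eq0 (q : rat) : to_rat_mod_int q = 0 <-> q \is a Num.int.
Proof. by rewrite /to_rat_mod_int quot_proj_eq0 submodule_ofP. Qed.

Lemma int_ideal_generated (I : ideal int) :
  exists d : nat, forall k : int, k \in I <-> (d %| k)%Z.
Proof.
have [[n [n0 nI]]|noI] := pselect (exists n : nat, (0 < n)%N /\ (n%:Z : int^o) \in I).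
  have ex : exists n : nat, (0 < n)%N && ((n%:Z : int^o) \in I) by exists n; apply/andP.
  case: (ex_minnP ex) => d /andP[d0 dI] dmin; exists d => k; split=> [kI|]; last first.
    by move=> /dvdzP[q ->]; exact: (rpredZ q (dI : (d%:Z : int^o) \in I)).
  apply/dvdz_mod0P; have d0' : (d%:Z != 0 :> int) by rewrite -lt0n.
  (* The remainder is a natural number below d in I, hence 0 by minimality. *)
  have mI : ((k %% d)%Z : int^o) \in I.
    have -> : (k %% d)%Z = k - (k %/ d)%Z *: (d%:Z : int^o).
      by rewrite {2}(divz_eq k d) addrC addKr.
    exact: submoduleB kI (rpredZ _ dI).
  have := ltz_mod k d0'; have := modz_ge0 k d0'; move: mI.
  case: (k %% d)%Z => // m mI _; rewrite ltz_nat absz_nat => md.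
  case: m => // m in mI md *.
  by have := dmin m.+1; rewrite mI /= leqNgt md => /(_ erefl).
exists 0%N => k; rewrite dvd0z; split=> [kI|/eqP ->]; last exact: (rpred0 I).
apply: contrapT => /negP k0; apply: noI; exists `|k|%N; rewrite absz_gt0 k0; split=> //.
by rewrite abszE; case: (ger0P k) => _ //; exact: submoduleN.
Qed.

(** Divisibility: a map on the ideal generated by d is determined by its value at
d, which has to be divided by d. *)
Lemma rat_mod_int_baer : baer rat_mod_int.
Proof.
move=> I f fI; have [d dP] := int_ideal_generated I.
have f0 : f 0 = 0.
  have := fI (-1) 0 0 (rpred0 I) (rpred0 I).
  by rewrite mulr0 addr0 scaleN1r addNr.
have [d0|d0] := eqVneq d 0%N.
  by exists 0 => k /dP; rewrite d0 dvd0z => /eqP ->; rewrite scaler0.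
have [q qd] := quot_proj_surj (f d).
exists (to_rat_mod_int ((q : rat) / d%:R)) => k kI.
have /dP/dvdzP[j ->] := kI.
have dI : (d%:Z : int^o) \in I by apply/dP; rewrite dvdzz.
have := fI j d 0 dI (rpred0 I); rewrite f0 !addr0 => ->.
rewrite -scalerA -qd; congr (_ *: _); rewrite -linearZ; congr (quot_proj _ _).
by rewrite scalezrE -mulrzr divfK // pnatr_eq0.
Qed.

(** An element m of finite order d generates a group on which m |-> 1/d is well
defined; for infinite order any nonzero value works, here 1/2. *)
Lemma separating_character (M : lmodType int) (m : M) : m != 0 ->
  exists h : {linear M -> rat_mod_int}, h m != 0.
Proof.
move=> m0.
have ann : is_submodule (fun k : int^o => (k : int) *: m = 0).
  split=> [|r x y xm ym]; first by rewrite scale0r.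
  by rewrite scalerDl -scalerA xm ym scaler0 addr0.
have [d dP] := int_ideal_generated (submodule_of ann).
have d1 : d != 1%N.
  apply: contra_neq m0 => d1.
  have /submodule_ofP : (1 : int^o) \in submodule_of ann by apply/dP; rewrite d1.
  by rewrite scale1r.
pose q : rat := if d == 0%N then 2%:R^-1 else d%:R^-1.
have q0 : to_rat_mod_int q <> 0.
  rewrite rat_mod_int_eq0 /q => /intrP[k].
  pose e := if d == 0%N then 2%N else d.
  have -> : (if d == 0%N then 2%:R^-1 else d%:R^-1) = e%:R^-1 :> rat by rewrite /e; case: ifP.
  have e1 : (1 < e)%N by rewrite /e; case: d d1 {dP q e} => [|[|]].
  move=> ek; have : e%:R * k%:~R = 1 :> rat.
    by rewrite -ek divff // pnatr_eq0 -lt0n (ltnW e1).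
  rewrite pmulrn -intrM => /eqP; rewrite (eqr_int _ _ 1) => /eqP/(congr1 absz).
  by rewrite abszM /= => /eqP; rewrite muln_eq1 gtn_eqF.
have kq k : (k : int) *: m = 0 -> k *: to_rat_mod_int q = 0.
  move=> km; have /dP : (k : int^o) \in submodule_of ann by apply/submodule_ofP.
  rewrite -linearZ; move=> /dvdzP[j ->]; apply/rat_mod_int_eq0.
  rewrite scalezrE /q; case: eqP => [->|/eqP d0]; first by rewrite mulr0 mulr0z rpred0.
  by rewrite -mulrzr intrM mulrCA pmulrn mulVf ?mulr1 ?intr_int // pnatr_eq0.
have HG : is_submodule (fun be : M * rat_mod_int =>
    exists k : int, be = (k *: m, k *: to_rat_mod_int q)).
  split=> [|r _ _ [k ->] [l ->]]; first by exists 0; rewrite !scale0r.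
  by exists (r * k + l); rewrite !scalerDl -!scalerA.
have [e /submodule_ofP[k [/esym km ->]]|h hP] :=
    baer_extends rat_mod_int_baer (G := submodule_of HG).
  exact: kq.
exists h; apply/eqP; rewrite (hP _ (to_rat_mod_int q)) //.
by apply/submodule_ofP; exists 1; rewrite !scale1r.
Qed.

End RationalsModIntegers.

Section Coinduced.
Variables (R : comPzRingType) (D : zmodType).

Definition is_additive : {pred R -> D} :=
  [pred phi | `[< forall x y, phi (x - y) = phi x - phi y >]].

Lemma is_additive_zmod_closed : zmod_closed is_additive.
Proof.
split=> [|phi psi /asboolP phiB /asboolP psiB]; apply/asboolP => x y.
  by rewrite subrr.
by rewrite !fctE phiB psiB !opprD !opprK addrACA.
Qed.
HB.instance Definition _ :=
  GRing.isZmodClosed.Build (R -> D) is_additive is_additive_zmod_closed.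

(** The coinduced module Hom_Z(R, D), with r acting by (r phi)(s) = phi(s r).
Additivity of phi is what makes this action additive in r, hence the passage
to a subtype before the module structure is put on it. *)
Definition coinduced := {phi : R -> D | phi \in is_additive}.
HB.instance Definition _ := SubChoice.on coinduced.
HB.instance Definition _ := [SubChoice_isSubZmodule of coinduced by <:].

Implicit Types (phi psi : coinduced) (r s : R).

Lemma coinducedB phi r s : val phi (r - s) = val phi r - val phi s.
Proof. by case: phi => phi /= /asboolP ->. Qed.
Lemma coinduced0 phi : val phi 0 = 0.
Proof. by rewrite -[in LHS](subrr 0) coinducedB subrr. Qed.
Lemma coinducedD phi r s : val phi (r + s) = val phi r + val phi s.
Proof. by rewrite -[s in LHS]opprK coinducedB -[- s]sub0r coinducedB coinduced0 sub0r opprK. Qed.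

Lemma coinduced_scale_subproof r phi : (fun s => val phi (s * r)) \in is_additive.
Proof. by apply/asboolP => x y; rewrite mulrBl coinducedB. Qed.
Definition coinduced_scale r phi : coinduced := 
  exist (fun f => f \in is_additive) _ (coinduced_scale_subproof r phi).

Lemma coinduced_scaleA r s phi :
  coinduced_scale r (coinduced_scale s phi) = coinduced_scale (r * s) phi.
Proof. by apply: val_inj; apply/funext => x /=; rewrite mulrA. Qed.
Lemma coinduced_scale1 : left_id 1 coinduced_scale.
Proof. by move=> phi; apply: val_inj; apply/funext => x /=; rewrite mulr1. Qed.
Lemma coinduced_scaleDr : right_distributive coinduced_scale +%R.
Proof. by move=> r phi psi; apply: val_inj. Qed.
Lemma coinduced_scaleDl phi : {morph coinduced_scale^~ phi : r s / r + s}.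
Proof.
move=> r s; apply: val_inj; apply/funext => x.
by rewrite /= mulrDr [LHS]coinducedD.
Qed.
HB.instance Definition _ := GRing.Zmodule_isLmodule.Build R coinduced
  coinduced_scaleA coinduced_scale1 coinduced_scaleDr coinduced_scaleDl.
Lemma coinducedZ r phi s : val (r *: phi) s = val phi (s * r).
Proof. by []. Qed.

End Coinduced.

Section EnoughInjectives.
Variable R : comPzRingType.

Definition extends_additive (D : zmodType) : Prop :=
  forall (A B : zmodType) (f : {additive A -> B}) (g : A -> D),
  injective f -> {morph g : x y / x - y} ->
  exists2 h : B -> D, {morph h : x y / x - y} & forall x, h (f x) = g x.

Lemma extends_additive_dual (X : Type) : extends_additive (X -> rat_mod_int).
Proof.
move=> A B f g fi gB.
have /choice[h hP] (t : X) : exists h : {linear zmodule B -> rat_mod_int},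
    forall a, h (f a) = g a t.
  have gtB : zmod_morphism (g^~ t) by move=> x y; rewrite gB.
  pose gt : {additive A -> rat_mod_int} :=
    HB.pack (g^~ t) (GRing.isZmodMorphism.Build _ _ _ gtB).
  have HG : is_submodule (fun be : zmodule B * rat_mod_int =>
      exists a, be = (f a, gt a)).
    split=> [|r _ _ [a ->] [b ->]]; first by exists 0; rewrite !raddf0.
    exists (a *~ r + b); rewrite !raddfD !raddfMz -[_ + _]/(_, _) /= scalezrE.
    by rewrite -[in RHS]scaler_int intz.
  have [e /submodule_ofP[a [fa ->]]|k kP] :=
      baer_extends rat_mod_int_baer (G := submodule_of HG).
    by have -> : a = 0; [apply: fi; rewrite raddf0 | apply: (raddf0 gt)].
  by exists k => a; apply/kP/submodule_ofP; exists a.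
exists (fun b t => h t b) => [x y|a]; apply/funext => t; last exact: hP.
exact: (linearB (h t)).
Qed.

(** Linear maps from B to Hom_Z(R, D) correspond to additive maps from B to D by
evaluation at 1, so extending the former reduces to extending the latter. *)
Lemma coinduced_injective (D : zmodType) :
  extends_additive D -> injective_module (coinduced R D).
Proof.
move=> extD A B f g fi.
have [x y|h hB hf] := extD A B f (fun a => val (g a) 1) fi.
  by rewrite linearB.
have h0 : h 0 = 0 by rewrite -[in LHS](subrr 0) hB subrr.
have hD x y : h (x + y) = h x + h y.
  by rewrite -[y in LHS]opprK hB -[- y]sub0r hB h0 sub0r opprK.
have hadd b : (fun s : R => h (s *: b)) \in @is_additive R D.
  by apply/asboolP => s t; rewrite scalerBl hB.
pose k b : coinduced R D := exist (fun f => f \in @is_additive R D) _ (hadd b).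
have klin : linear k.
  move=> r x y; apply: val_inj; apply/funext => s.
  by rewrite /= scalerDr hD scalerA.
exists (linear_of klin) => a; apply: val_inj; apply/funext => s.
by rewrite /= -linearZ hf linearZ coinducedZ mul1r.
Qed.

(** The map m |-> (s |-> (h |-> h(s m))), with h ranging over the characters of M,
is injective because characters separate elements. *)
Lemma enough_injectives (M : lmodType R) :
  exists (E : lmodType R) (e : {linear M -> E}), injective_module E /\ injective e.
Proof.
pose chars := {linear zmodule M -> rat_mod_int}.
pose D := (chars -> rat_mod_int) : zmodType.
have Hadd m : (fun (s : R) => (fun h : chars => h (s *: m : zmodule M)) : D) \in @is_additive R D.
  by apply/asboolP => s t; apply/funext => h; rewrite scalerBl (linearB h).
pose k m : coinduced R D := exist (fun f => f \in @is_additive R D) _ (Hadd m).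
have klin : linear k.
  move=> r x y; apply: val_inj; apply/funext => s; apply/funext => h.
  by rewrite /= scalerDr (linearD h) scalerA.
exists (coinduced R D), (linear_of klin); split.
  exact/coinduced_injective/extends_additive_dual.
move=> x y /(congr1 val) xy; apply/subr0_eq; apply: contrapT => /eqP.
move=> /(@separating_character (zmodule M))[h /eqP]; apply.
rewrite (linearB h); apply/eqP; rewrite subr_eq0; apply/eqP.
by have := congr1 (fun f : R -> D => f 1 h) xy; rewrite /= !scale1r.
Qed.

End EnoughInjectives.

(** * Torsion and injectivity *)

Section Torsion.
Variables (R : comPzRingType) (a : ideal R).
Implicit Types (M E : lmodType R).

Definition gamma M : submodClosed M := @torsion R a M.

Lemma gammaP M (x : M) :
  x \in gamma M <-> exists n, forall r, ideal_exp a n r -> r *: x = 0.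
Proof. by split=> /asboolP. Qed.

Lemma gamma_linear M E (f : {linear M -> E}) x : x \in gamma M -> f x \in gamma E.
Proof.
move=> /gammaP[n xn]; apply/gammaP; exists n => r /xn rx.
by rewrite -linearZ rx linear0.
Qed.

Lemma gamma_reflect M E (f : {linear M -> E}) x :
  injective f -> f x \in gamma E -> x \in gamma M.
Proof.
move=> fi /gammaP[n fxn]; apply/gammaP; exists n => r /fxn.
by rewrite -linearZ -(linear0 f) => /fi.
Qed.

Lemma ideal_exp_expr n (x : R) : x \in a -> ideal_exp a n (x ^+ n).
Proof.
move=> xa; elim: n => [//|n IHn]; exists 1%N, (fun=> x), (fun=> x ^+ n).
by split=> //; rewrite big_ord1 exprS.
Qed.

Lemma gamma_exp M (y : M) x : x \in a -> y \in gamma M -> exists n, x ^+ n *: y = 0.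
Proof. by move=> xa /gammaP[n yn]; exists n; apply/yn/ideal_exp_expr. Qed.

Hypothesis noeR : noetherian R.

(** It suffices to test powers of single elements since a is finitely generated:
if x_j^(k_j) kills y for generators x_j of a, then a^(1 + sum k_j) kills y, by
induction on the sum. *)
Lemma gamma_of_exp M (y : M) :
  (forall x, x \in a -> exists n, x ^+ n *: y = 0) -> y \in gamma M.
Proof.
move=> ay; have [n [g gP]] := noeR a.
have /choice[k kP] i : exists m, (g i : R) ^+ m *: y = 0.
  exact/ay/(generates_mem _ gP).
have [S kS] : exists S, (\sum_i k i <= S)%N by exists (\sum_i k i)%N.
apply/gammaP; exists S.+1; move: {ay} kS; elim: S y k kP => [|S IHS] y k kP kS r [m [f [h [fh ->]]]].
  have [n0|n0] := posnP n.
    rewrite big1 ?scale0r // => i _; have [/gP[c ->] _] := fh i.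
    by rewrite big1 ?mul0r // => j; have := leq_trans (ltn_ord j) (eq_leq n0).
  have := kP (Ordinal n0); have : k (Ordinal n0) == 0%N.
    rewrite -leqn0; apply: leq_trans kS.
    by rewrite (bigD1 (Ordinal n0)) //= leq_addr.
  by move=> /eqP ->; rewrite expr0 scale1r => ->; rewrite scaler0.
rewrite scaler_suml big1 // => i _; have [/gP[c ->] hS] := fh i.
rewrite mulr_suml scaler_suml big1 // => j _; rewrite -mulrA -scalerA mulrC.
rewrite -scalerA [h i *: _](_ : _ = 0) ?scaler0 //.
have [kj0|kj0] := posnP (k j).
  by have := kP j; rewrite kj0 expr0 scale1r => ->; rewrite !scaler0.
apply: (IHS _ (fun l => k l - (l == j))%N) hS => [l|].
  have [->|lj] := eqVneq l j; last first.
    by rewrite subn0 scalerA mulrC -scalerA kP scaler0.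
  by rewrite scalerA -exprSr subn1 prednK.
rewrite -ltnS; apply: leq_trans kS; rewrite [X in (_ < X)%N](bigD1 j) //=.
rewrite (bigD1 j) //= eqxx subn1 -addSn prednK // leq_add2l.
by apply: leq_sum => l _; apply: leq_subr.
Qed.

(** The ascending chain of the colon ideals (K : x^m) is stationary. *)
Lemma noetherian_exp_colon (K : ideal R) (x : R) :
  exists m, forall n y, x ^+ (m + n) * y \in K -> x ^+ m * y \in K.
Proof.
have sub m : is_submodule (fun y : R^o => (x ^+ m * (y : R) : R^o) \in K).
  split=> [|r y z yK zK]; first by rewrite mulr0 (rpred0 K).
  rewrite mulrDr [x ^+ m * (r *: y)]mulrCA.
  exact: rpredD (rpredZ r yK) zK.
have [C [[m ->] Cmax]] := noetherian_max
  (F := fun C => exists m, C = submodule_of (sub m)) noeR (ex_intro _ 0%N erefl).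
exists m => n y xy; apply/(submodule_ofP (sub m)).
apply: (Cmax (submodule_of (sub (m + n)%N))); first by exists (m + n)%N.
  move=> z /submodule_ofP zK; apply/submodule_ofP.
  by rewrite addnC exprD -mulrA; exact: rpredZ zK.
exact/submodule_ofP.
Qed.

(** Let f map an ideal I linearly to the torsion part of E, and let K be maximal
among the ideals that contain the kernel of f and meet I in it.  Every x in a
has a power in K: each r in I is sent to the kernel of f by some power of x, so
if m makes the chain (K : x^m) stationary, K + (x^m) still meets I in the
kernel, and maximality gives x^m in K.  Hence f extended by 0 on K extends further to
r |-> r e with e in E, and e is torsion because K kills it. *)
Lemma gamma_injective E : injective_module E -> injective_module (torsion_functor a E).
Proof.
move=> injE; apply: baer_injective => I f fI.
have f0 : f 0 = 0.
  have := fI (-1) 0 0 (rpred0 I) (rpred0 I).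
  by rewrite mulr0 addr0 scaleN1r addNr.
have fZ r x : x \in I -> f (r * x) = r *: f x.
  by move=> xI; have := fI r x 0 xI (rpred0 I); rewrite f0 !addr0.
have Jsub : is_submodule (fun r : R^o => r \in I /\ f r = 0).
  split=> [|r x y [xI fx] [yI fy]]; first by rewrite (rpred0 I).
  split; last by rewrite fI // fx fy scaler0 addr0.
  exact: rpredD (rpredZ r xI) yI.
pose J := submodule_of Jsub.
have [K [[JK KI] Kmax]] := noetherian_max (F := fun K : ideal R =>
    {subset J <= K} /\ forall r, r \in I -> r \in K -> f r = 0) (N0 := J) noeR
  (conj (fun _ => id) (fun r _ rJ => ((submodule_ofP Jsub r).1 rJ).2)).
have aK x : x \in a -> exists m, x ^+ m \in K.
  move=> xa; have [m mP] := noetherian_exp_colon K x; exists m.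
  have K'sub : is_submodule (fun r : R^o => exists2 k : R^o, k \in K &
      exists y : R, r = k + x ^+ m * y).
    split=> [|r _ _ [k kK [y ->]] [l lK [z ->]]].
      by exists 0; [exact: (rpred0 K) | exists 0; rewrite mulr0 addr0].
    exists (r *: k + l); first exact: rpredD (rpredZ r kK) lK.
    by exists (r * y + z); rewrite mulrDr mulrCA [r *: (_ + _)]mulrDr addrACA.
  apply: (Kmax (submodule_of K'sub)); last first.
  - by apply/submodule_ofP; exists 0; [exact: (rpred0 K)|exists 1; rewrite mulr1 add0r].
  - move=> k kK; apply/submodule_ofP; exists k => //.
    by exists 0; rewrite mulr0 addr0.
  split=> [k /JK kK|r rI /submodule_ofP[k kK [y rE]]].
    by apply/submodule_ofP; exists k => //; exists 0; rewrite mulr0 addr0.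
  have [n xnr] := gamma_exp xa (sub_incl_in (f r : submod_type (gamma E))).
  have xnrK : x ^+ n * r \in K.
    apply: JK; apply/submodule_ofP; split; first exact: (rpredZ (x ^+ n) rI).
    rewrite fZ //; apply: val_inj; rewrite /= -[RHS]xnr.
    by [].
  apply: KI rI _; rewrite rE; apply: (rpredD kK); apply: (mP n).
  have -> : x ^+ (m + n) * y = x ^+ n * r - x ^+ n *: (k : R^o).
    by rewrite rE mulrDr addrAC subrr add0r mulrA -exprD addnC.
  exact: submoduleB xnrK (rpredZ _ kK).
have HG : is_submodule (fun be : R^o * E => exists2 k, k \in K &
    exists2 r, r \in I & be = (k + r, sub_incl (gamma E) (f r))).
  split=> [|s _ _ [k kK [r rI ->]] [k' kK' [r' rI' ->]]].
    exists 0; first exact: (rpred0 K).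
    by exists 0; [exact: (rpred0 I) | rewrite f0 addr0 linear0].
  exists (s *: k + k'); first exact: rpredD (rpredZ s kK) kK'.
  exists (s *: r + r'); first exact: rpredD (rpredZ s rI) rI'.
  rewrite fI // linearP -[_ + _]/(_, _) /=; congr pair.
  by rewrite scalerDr addrACA.
have [e /submodule_ofP[k kK [r rI [/esym kr ->]]]|h hP] :=
    injective_extends injE (G := submodule_of HG).
  rewrite KI ?linear0 //; move/eqP: kr; rewrite addrC addr_eq0 => /eqP ->.
  exact: submoduleN.
have hI r : r \in I -> h r = sub_incl (gamma E) (f r).
  move=> rI; apply/hP/submodule_ofP; exists 0; first exact: (rpred0 K).
  by exists r; rewrite ?add0r.
have hK k : k \in K -> h k = 0.
  move=> kK; apply/hP/submodule_ofP; exists k => //; exists 0; first exact: (rpred0 I).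
  by rewrite addr0 f0 linear0.
have h1 r : h r = r *: h 1 by rewrite -linearZ /= [_ *: _]mulr1.
have /sub_inclP[e0 e0h] : h 1 \in gamma E.
  by apply: gamma_of_exp => x /aK[m xm]; exists m; rewrite -h1 hK.
exists e0 => r rI; apply: (@sub_incl_inj _ _ (gamma E)).
by rewrite linearZ e0h -hI.
Qed.

(** One embedding serves both purposes, so that iterating it resolves every module
by injectives and torsion modules by torsion injectives. *)
Lemma torsion_embedding M : exists (E : lmodType R) (e : {linear M -> E}),
  [/\ injective_module E, injective e &
      (forall x : M, x \in gamma M) -> forall y : E, y \in gamma E].
Proof.
have [E [e [injE ei]]] := enough_injectives M.
have [Mt|] := pselect (forall x : M, x \in gamma M); last by exists E, e.
exists (torsion_functor a E), (corestrict (fun x => gamma_linear e (Mt x))).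
split; first exact: gamma_injective.
  by move=> x y xy; apply: ei; rewrite -(corestrictK (fun x => gamma_linear e (Mt x))) xy.
move=> _ y; have /gammaP[n yn] := sub_incl_in (y : submod_type (gamma E)).
apply/gammaP; exists n => r /yn ry; apply: (@sub_incl_inj _ _ (gamma E)).
by rewrite linear0 -[RHS]ry linearZ.
Qed.

End Torsion.

(** * Injective resolutions *)

(** Dependent choice for sequences whose n-th term lives in a type S n. *)
Lemma dependent_sequence (S : nat -> Type) (Rel : forall n, S n -> S n.+1 -> Prop)
    (s0 : S 0%N) :
  (forall n s, exists s', Rel n s s') ->
  exists s : forall n, S n, s 0%N = s0 /\ forall n, Rel n (s n) (s n.+1).
Proof.
move=> next; pose nxt n s := projT1 (cid (next n s)).
exists (fix s n := if n is m.+1 then nxt m (s m) else s0); split=> // n.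
by rewrite /nxt; case: cid.
Qed.

Section Resolutions.
Variable R : comPzRingType.
Implicit Types (A B C M : lmodType R) (T : cochain_complex R).

Lemma augmentation_d M (I : injective_resolution M) m :
  differential I 0 (augmentation I m) = 0.
Proof. by apply/augmentation_exact; exists m. Qed.

Section Comparison.
Variables (M : lmodType R) (L : injective_resolution M) (T : cochain_complex R).
Hypothesis injT : forall n, injective_module (T n).

(** The comparison theorem.  The invariant carried along the construction is that
F n sends cocycles to cocycles: by exactness of L it is what allows the next
extension. *)
Lemma lift_to_resolution (phi : {linear M -> T 0%N}) :
  (forall m, differential T 0 (phi m) = 0) ->
  exists F : forall n, {linear L n -> T n},
    (forall m, F 0%N (augmentation L m) = phi m) /\
    forall n x, F n.+1 (differential L n x) = differential T n (F n x).
Proof.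
move=> dphi.
have [F0 F0P] : exists F0 : {linear L 0%N -> T 0%N},
    forall m, F0 (augmentation L m) = phi m.
  apply: injective_extend_along => // m; rewrite -(linear0 (augmentation L)).
  by move=> /augmentation_inj ->; rewrite linear0.
pose S n := {F : {linear L n -> T n} |
  forall x, differential L n x = 0 -> differential T n (F x) = 0}.
have S0 x : differential L 0 x = 0 -> differential T 0 (F0 x) = 0.
  by move=> /augmentation_exact[m <-]; rewrite F0P dphi.
have [n [F FP]|F [FE FP]] := @dependent_sequence S
  (fun n F F' => forall x, sval F' (differential L n x) = differential T n (sval F x))
  (exist _ F0 S0).
  have [F' F'P] := injective_extend_along (u := differential L n)
    (v := differential T n \o F) (@injT n.+1) FP.
  have SF' x : differential L n.+1 x = 0 -> differential T n.+1 (F' x) = 0.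
    by move=> /resolution_exact[y <-]; rewrite F'P differentialK.
  by exists (exist _ F' SF').
by exists (fun n => sval (F n)); rewrite FE.
Qed.

(** A chain map that is zero on M is homotopic to zero; taken for a difference
of two lifts, this is uniqueness of lifts up to homotopy. *)
Lemma null_homotopy (F : forall n, {linear L n -> T n}) :
  (forall m, F 0%N (augmentation L m) = 0) ->
  (forall n x, F n.+1 (differential L n x) = differential T n (F n x)) ->
  exists h : forall n, {linear L n.+1 -> T n},
    (forall x, F 0%N x = h 0%N (differential L 0 x)) /\
    forall n x, F n.+1 x = differential T n (h n x) + h n.+1 (differential L n.+1 x).
Proof.
move=> Faug Fd.
have [|h0 h0P] := injective_extend_along (u := differential L 0) (v := F 0%N) (@injT 0%N).
  by move=> x /augmentation_exact[m <-].
pose S n := {h : {linear L n.+1 -> T n} | forall x,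
  differential T n (h (differential L n x)) = F n.+1 (differential L n x)}.
have S0 x : differential T 0 (h0 (differential L 0 x)) = F 1%N (differential L 0 x).
  by rewrite h0P Fd.
have [n [h hP]|h [hE hP]] := @dependent_sequence S
  (fun n h h' => forall x, F n.+1 x = differential T n (sval h x)
     + sval h' (differential L n.+1 x)) (exist _ h0 S0).
  have lin : linear (fun x => F n.+1 x - differential T n (h x)).
    by move=> r x y; rewrite !linearP /= addrACA -scalerDr.
  have [|h' h'P] := injective_extend_along (u := differential L n.+1)
      (v := linear_of lin) (@injT n.+1).
    by move=> x /resolution_exact[y <-]; rewrite /= /linear_fun hP subrr.
  have Sh' x : differential T n.+1 (h' (differential L n.+1 x)) =
      F n.+2 (differential L n.+1 x).
    by rewrite h'P Fd /= /linear_fun linearB differentialK subr0.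
  exists (exist _ h' Sh') => x /=; rewrite h'P.
  by rewrite /= /linear_fun addrC subrK.
by exists (fun n => sval (h n)); split=> // x; rewrite hE h0P.
Qed.

(** The same for maps G of degree one that anticommute with the differentials.
Here G need not be zero on M: it may be the differential of some psi, which
provides the start of the homotopy. *)
Lemma shifted_homotopy (G : forall n, {linear L n -> T n.+1})
    (psi : {linear M -> T 0%N}) :
  (forall m, G 0%N (augmentation L m) = differential T 0 (psi m)) ->
  (forall n x, G n.+1 (differential L n x) = - differential T n.+1 (G n x)) ->
  exists h : forall n, {linear L n -> T n},
    forall n x, G n x = differential T n (h n x) - h n.+1 (differential L n x).
Proof.
move=> Gaug Gd.
have [|h0 h0P] := injective_extend_along (u := augmentation L) (v := psi) (@injT 0%N).
  by move=> m; rewrite -(linear0 (augmentation L)) => /augmentation_inj ->; rewrite linear0.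
pose S n := {h : {linear L n -> T n} | forall x, differential L n x = 0 ->
  G n x = differential T n (h x)}.
have S0 x : differential L 0 x = 0 -> G 0%N x = differential T 0 (h0 x).
  by move=> /augmentation_exact[m <-]; rewrite h0P.
have [n [h hP]|h [hE hP]] := @dependent_sequence S
  (fun n h h' => forall x, G n x = differential T n (sval h x)
     - sval h' (differential L n x)) (exist _ h0 S0); last first.
  by exists (fun n => sval (h n)).
have lin : linear (fun x => differential T n (h x) - G n x).
  by move=> r x y; rewrite !linearP /= addrACA -scalerDr.
have [|h' h'P] := injective_extend_along (u := differential L n)
    (v := linear_of lin) (@injT n.+1).
  by move=> x /hP; rewrite /= /linear_fun => ->; rewrite subrr.
have Sh' x : differential L n.+1 x = 0 -> G n.+1 x = differential T n.+1 (h' x).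
  move=> /resolution_exact[y <-]; rewrite Gd h'P /= /linear_fun.
  by rewrite linearB differentialK sub0r.
by exists (exist _ h' Sh') => x /=; rewrite h'P /= /linear_fun subKr.
Qed.

End Comparison.

(** The sign makes chain maps to the shift anticommute with the original
differential, as the twisting maps of the horseshoe must. *)
Section NegatedShift.
Variable T : cochain_complex R.
Lemma linear_negated_d n : linear (fun x => - differential T n x).
Proof. by move=> r x y; rewrite !linearP. Qed.
Lemma negated_dK n x :
  linear_of (@linear_negated_d n.+2) (linear_of (@linear_negated_d n.+1) x) = 0.
Proof. by rewrite /= /linear_fun linearN opprK differentialK. Qed.
Definition negated_shift : cochain_complex R :=
  CochainComplex (cochain := fun n => T n.+1) negated_dK.
End NegatedShift.

Section Horseshoe.
Variables (A B C : lmodType R) (f : {linear A -> B}) (g : {linear B -> C}).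
Hypothesis fg : short_exact f g.
Variables (I : injective_resolution A) (L : injective_resolution C).

(** The resolution of B has terms I n * L n and upper triangular differentials
with off-diagonal entry t.  The hypotheses on t and e say that this is a
complex, and that (e, augmentation) augments it by B. *)
Section Twist.
Variables (t : forall n, {linear L n -> I n.+1}) (e : {linear B -> I 0%N}).
Hypothesis td : forall n v, t n.+1 (differential L n v) = - differential I n.+1 (t n v).
Hypothesis ef : forall x, e (f x) = augmentation I x.
Hypothesis te : forall y, t 0%N (augmentation L (g y)) = - differential I 0 (e y).

Lemma linear_twisted n : linear (fun uv : I n * L n =>
  (differential I n uv.1 + t n uv.2, differential L n uv.2)).
Proof.
by move=> r x y; rewrite /= !linearP addrACA -scalerDr.
Qed.
Definition twisted_d n : {linear (I n * L n)%type -> (I n.+1 * L n.+1)%type} :=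
  linear_of (@linear_twisted n).

Lemma twisted_dE n u v :
  twisted_d n (u, v) = (differential I n u + t n v, differential L n v).
Proof. by []. Qed.

Lemma twisted_dK n x : twisted_d n.+1 (twisted_d n x) = 0.
Proof.
case: x => u v; rewrite !twisted_dE linearD !differentialK td.
by rewrite add0r subrr.
Qed.

Definition twisted_complex : cochain_complex R :=
  CochainComplex (cochain := fun n => (I n * L n)%type : lmodType R) twisted_dK.

Lemma linear_horseshoe_aug : linear (fun b => (e b, augmentation L (g b))).
Proof. by move=> r x y; rewrite !linearP. Qed.
Definition horseshoe_aug : {linear B -> twisted_complex 0%N} :=
  linear_of linear_horseshoe_aug.
Lemma horseshoe_augE b : horseshoe_aug b = (e b, augmentation L (g b)).
Proof. by []. Qed.

Lemma horseshoe_injective n : injective_module (twisted_complex n).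
Proof. by apply: injective_prod; apply: resolution_injective. Qed.

Lemma horseshoe_aug_inj : injective horseshoe_aug.
Proof.
move=> x y xy; apply/subr0_eq; have [fi _ gf] := fg.
have := linearB horseshoe_aug x y; rewrite xy subrr horseshoe_augE => -[e0].
rewrite -(linear0 (augmentation L)) => /augmentation_inj/gf[z zE].
move: e0; rewrite -zE ef -(linear0 (augmentation I)) => /augmentation_inj ->.
by rewrite linear0.
Qed.

Lemma horseshoe_aug_exact x :
  differential twisted_complex 0 x = 0 <-> exists b, horseshoe_aug b = x.
Proof.
have [_ gs gf] := fg.
split=> [|[b <-]]; last first.
  by rewrite horseshoe_augE [LHS]twisted_dE te subrr augmentation_d.
case: x => u v; rewrite [differential _ _]/(twisted_d 0) twisted_dE.
move=> [+ /augmentation_exact[c vc]]; have [b bc] := gs c.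
rewrite -vc -bc te -linearB => /augmentation_exact[x xE].
have gfx : g (f x) = 0 by apply/gf; exists x.
exists (b + f x); rewrite horseshoe_augE !linearD gfx ef linear0 addr0 xE.
by rewrite addrC subrK.
Qed.

Lemma horseshoe_exact n x :
  differential twisted_complex n.+1 x = 0 ->
  exists y, differential twisted_complex n y = x.
Proof.
case: x => u v; rewrite [differential _ _]/(twisted_d n.+1) twisted_dE.
move=> [+ /resolution_exact[v' vE]]; rewrite -vE td -linearB.
move=> /resolution_exact[u' uE]; exists (u', v').
by rewrite [LHS]twisted_dE uE subrK.
Qed.

Definition horseshoe : injective_resolution B :=
  InjectiveResolution horseshoe_injective horseshoe_aug_inj horseshoe_aug_exact
    horseshoe_exact.

End Twist.

(** The map t lifts to L the map C -> I 1 that sends the class of b to - d (e b),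
where e extends the augmentation of I from A to B. *)
Lemma horseshoe_twist : exists (t : forall n, {linear L n -> I n.+1})
    (e : {linear B -> I 0%N}),
  [/\ forall n v, t n.+1 (differential L n v) = - differential I n.+1 (t n v),
      forall x, e (f x) = augmentation I x &
      forall y, t 0%N (augmentation L (g y)) = - differential I 0 (e y)].
Proof.
have [fi gs gf] := fg.
have [e ef] := resolution_injective (augmentation I) fi.
have lin : linear (fun y => - differential I 0 (e y)).
  by move=> r x y; rewrite !linearP.
have [|phi phiP] := injective_extend_along (u := g) (v := linear_of lin)
    (@resolution_injective _ _ I 1%N).
  by move=> b /gf[x <-]; rewrite /= /linear_fun ef augmentation_d oppr0.
have [n|c|t [taug td]] := @lift_to_resolution C L (negated_shift I) _ phi.
- exact: resolution_injective.
- have [b <-] := gs c; rewrite phiP.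
  by rewrite /= /linear_fun linearN differentialK !oppr0.
by exists t, e; split=> // y; rewrite taug phiP.
Qed.

End Horseshoe.

End Resolutions.

(** * Vanishing of local cohomology *)

Section Vanishing.
Variables (R : comPzRingType) (a : ideal R).
Hypothesis noeR : noetherian R.
Implicit Types (A B C M : lmodType R) (T : cochain_complex R).

(** Embed M, and then repeatedly the cokernel of the preceding embedding; each of
these cokernels inherits torsion from M. *)
Lemma exists_resolution M : exists I : injective_resolution M,
  (forall x : M, x \in gamma a M) -> forall n (y : I n), y \in gamma a (I n).
Proof.
pose E A := projT1 (cid (torsion_embedding a noeR A)).
have /all_sig[e eP] : forall A, {e : {linear A -> E A} |
    [/\ injective_module (E A), injective e &
        (forall x : A, x \in gamma a A) -> forall y : E A, y \in gamma a (E A)]}.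
  by move=> A; apply: cid; rewrite /E; case: cid.
pose fix S n : lmodType R :=
  if n is m.+1 then quot_mod (image_of (e (S m)) (full_submodule (S m))) else M.
pose pr n : {linear E (S n) -> S n.+1} :=
  quot_proj (image_of (e (S n)) (full_submodule (S n))).
pose d n : {linear E (S n) -> E (S n.+1)} := e (S n.+1) \o pr n.
have pr0 n x : pr n x = 0 <-> exists y, e (S n) y = x.
  rewrite quot_proj_eq0 image_ofP; split=> [[y _ <-]|[y <-]]; first by exists y.
  by exists y => //; apply: full_submoduleP.
have d0 n x : d n x = 0 <-> exists y, e (S n) y = x.
  rewrite -pr0; split=> [|px]; last by rewrite /d /= px linear0.
  by case: (eP (S n.+1)) => _ ei _; rewrite -(linear0 (e (S n.+1))) => /ei.
have dd n x : d n.+1 (d n x) = 0 by apply/d0; exists (pr n x).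
have dex n x : d n.+1 x = 0 -> exists y, d n y = x.
  by move=> /d0[y <-]; have [z <-] := quot_proj_surj y; exists z.
pose K := CochainComplex (cochain := fun n => E (S n)) dd.
have Kinj n : injective_module (K n) by case: (eP (S n)).
have e0 : injective (e M : M -> K 0%N) by case: (eP M).
exists (InjectiveResolution (resolution := K) Kinj e0 (d0 0%N) dex) => MT n.
have [_ _] := eP (S n); apply; elim: n => [//|n IHn] y.
have [x <-] := quot_proj_surj y; apply: (gamma_linear (pr n)).
by have [_ _] := eP (S n); apply.
Qed.

(** The coboundaries of the torsion subcomplex, seen in the ambient complex: the
preimage is required to be torsion as well. *)
Definition torsion_boundary T n : T n -> Prop :=
  if n is m.+1 then fun x => exists2 y, y \in gamma a (T m) & differential T m y = x
  else fun x => x = 0.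

Definition acyclic_at T n : Prop := forall x : T n,
  x \in gamma a (T n) -> differential T n x = 0 -> torsion_boundary x.

Lemma torsion_boundaryB T n (x y : T n) :
  torsion_boundary x -> torsion_boundary y -> torsion_boundary (x - y).
Proof.
case: n x y => [|n] x y /=; first by move=> -> ->; rewrite subrr.
move=> [u ut <-] [v vt <-]; exists (u - v); first exact: submoduleB.
by rewrite linearB.
Qed.

Lemma torsion_boundary_map T T' (F : forall n, {linear T n -> T' n}) :
  (forall n x, F n.+1 (differential T n x) = differential T' n (F n x)) ->
  forall n (x : T n), torsion_boundary x -> torsion_boundary (F n x).
Proof.
move=> Fd [|n] x /=; first by move=> ->; rewrite linear0.
by move=> [y yt <-]; exists (F n y); [exact: gamma_linear | rewrite Fd].
Qed.

Lemma null_homotopic_boundary T T' (F : forall n, {linear T n -> T' n})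
    (h : forall n, {linear T n.+1 -> T' n}) :
  (forall x, F 0%N x = h 0%N (differential T 0 x)) ->
  (forall n x, F n.+1 x = differential T' n (h n x) + h n.+1 (differential T n.+1 x)) ->
  forall n (x : T n), x \in gamma a (T n) -> differential T n x = 0 ->
  torsion_boundary (F n x).
Proof.
move=> F0 FS [|n] x xt dx /=; first by rewrite F0 dx linear0.
by exists (h n x); [exact: gamma_linear | rewrite FS dx linear0 addr0].
Qed.

Lemma local_cohomology_neq0P M i :
  local_cohomology_neq0 a M i <-> exists I : injective_resolution M, ~ acyclic_at I i.
Proof.
have bdE (I : injective_resolution M) (x : torsion_complex a I i) :
    is_coboundary x <-> torsion_boundary (sub_incl (gamma a (I i)) x).
  case: i x => [|i] x /=.
    rewrite -(linear0 (sub_incl (gamma a (I 0%N)))).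
    by split=> [->|/sub_incl_inj].
  split=> [[y <-]|[y yt yx]]; first by exists (val y); [exact: valP |].
  have /sub_inclP[z zy] := yt; exists z; apply: val_inj.
  by rewrite -[RHS]yx -zy.
split=> -[I].
  move=> [u u0]; exists I => acy; move/eqP: u0; apply.
  have [x xu] := quot_proj_surj u; rewrite -xu; apply/quot_proj_eq0/asboolP.
  apply/bdE/acy; first exact: sub_incl_in.
  have := valP x; rewrite inE => /eqP/(congr1 val).
  by [].
move=> /existsNP[x /not_implyP[xt /not_implyP[dx xb]]]; exists I.
have /sub_inclP[y yx] := xt.
have yc : y \in @cocycle R (torsion_complex a I) i.
  by apply/eqP/val_inj; rewrite -[RHS]dx -yx.
exists (quot_mod_pi (@coboundary R (torsion_complex a I) i) (Sub y yc)).
apply/eqP => /(quot_proj_eq0 (@coboundary R (torsion_complex a I) i))/asboolP/bdE.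
by rewrite SubK yx.
Qed.

(** Lifts F : I -> J and G : J -> I of the identity have G F homotopic to the
identity, and homotopies are linear, so they preserve torsion. *)
Lemma acyclic_at_indep M (I J : injective_resolution M) i :
  acyclic_at J i -> acyclic_at I i.
Proof.
move=> acJ z zt dz.
have [F [Faug Fd]] := lift_to_resolution I (@resolution_injective _ _ J)
  (augmentation_d J).
have [G [Gaug Gd]] := lift_to_resolution J (@resolution_injective _ _ I)
  (augmentation_d I).
have lin n : linear (fun x => G n (F n x) - x).
  by move=> r x y; rewrite !linearP /= addrACA -scalerDr.
pose D n : {linear I n -> I n} := linear_of (lin n).
have [m|n x|h [h0 hS]] := null_homotopy (@resolution_injective _ _ I) (F := D).
- by rewrite /= /linear_fun Faug Gaug subrr.
- by rewrite /= /linear_fun Fd Gd linearB.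
have H := null_homotopic_boundary (F := D) h0 hS zt dz.
rewrite -[z](subKr (G i (F i z))); apply: torsion_boundaryB H.
apply: (torsion_boundary_map Gd); apply: acJ; first exact: gamma_linear.
by rewrite -Fd dz linear0.
Qed.

Definition vanishes M i : Prop := ~ local_cohomology_neq0 a M i.

Lemma vanishesP M i (I : injective_resolution M) : vanishes M i <-> acyclic_at I i.
Proof.
rewrite /vanishes local_cohomology_neq0P; split=> [|acI [J]]; last first.
  by apply; apply: acyclic_at_indep acI.
by move=> noJ; apply: contrapT => acI; apply: noJ; exists I.
Qed.

Lemma gamma_pairP A B (u : A) (v : B) :
  (u, v) \in gamma a (A * B)%type <-> u \in gamma a A /\ v \in gamma a B.
Proof.
split=> [/gammaP[n uvn]|[/gammaP[m um] /gammaP[n vn]]].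
  by split; apply/gammaP; exists n => r /uvn[].
apply/gammaP; exists (m + n)%N => r rmn; rewrite -[_ *: _]/(_, _) /=.
rewrite vn; last exact: ideal_expD rmn.
by rewrite um //; move: rmn; rewrite addnC; apply: ideal_expD.
Qed.

Section ShortExact.
Variables (A B C : lmodType R) (f : {linear A -> B}) (g : {linear B -> C}).
Hypothesis fg : short_exact f g.

Lemma exists_horseshoe : exists (I : injective_resolution A) (L : injective_resolution C)
    (t : forall n, {linear L n -> I n.+1}) (e : {linear B -> I 0%N})
    (td : forall n v, t n.+1 (differential L n v) = - differential I n.+1 (t n v))
    (ef : forall x, e (f x) = augmentation I x)
    (te : forall y, t 0%N (augmentation L (g y)) = - differential I 0 (e y)), True.
Proof.
have [I _] := exists_resolution A; have [L _] := exists_resolution C.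
have [t [e [td ef te]]] := horseshoe_twist fg I L.
by exists I, L, t, e, td, ef, te.
Qed.

(** Exactness of H^i(A) -> H^i(B) -> H^i(C) in the middle. *)
Lemma vanishes_ext i : vanishes A i -> vanishes C i -> vanishes B i.
Proof.
have [I [L [t [e [td [ef [te _]]]]]]] := exists_horseshoe.
rewrite (vanishesP i I) (vanishesP i L) (vanishesP i (horseshoe fg td ef te)).
move=> acI acL [u v] /gamma_pairP[ut vt] [uv dv]; have := acL v vt dv.
case: i u v ut vt uv dv {acL} acI => [|i] u v ut vt uv dv acI /=.
  by move=> vE; move: uv; rewrite vE linear0 addr0 => /(acI _ ut) ->.
move=> [v' v't v'E].
have [||u' u't u'E] := acI (u - t i v').
- by rewrite submoduleB // gamma_linear.
- by rewrite linearB -td v'E.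
exists (u', v'); first exact/gamma_pairP.
by rewrite [LHS]twisted_dE u'E v'E subrK.
Qed.

(** Exactness of H^i(B) -> H^i(C) -> H^(i+1)(A) in the middle; the connecting map
is induced by the twist t. *)
Lemma vanishes_surj i : vanishes B i -> vanishes A i.+1 -> vanishes C i.
Proof.
have [I [L [t [e [td [ef [te _]]]]]]] := exists_horseshoe.
rewrite (vanishesP _ I) (vanishesP _ L) (vanishesP _ (horseshoe fg td ef te)).
move=> acJ acI v vt dv.
have [||u ut uE] := acI (t i v); first exact: gamma_linear.
  by apply/eqP; rewrite -oppr_eq0 -td dv linear0.
have /acJ : ((- u, v) : twisted_complex td i) \in gamma a _.
  by apply/gamma_pairP; rewrite submoduleN.
have duv : differential (twisted_complex td) i (- u, v) = 0.
  by rewrite [LHS]twisted_dE linearN uE addNr dv.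
move=> /(_ duv); case: i u v {ut uE vt dv duv acI acJ} => [|i] u v /=.
  by move=> -[].
by move=> [[u' v'] /gamma_pairP[u't v't] [_ v'E]]; exists v'.
Qed.

(** Injectivity of H^(i+1)(A) -> H^(i+1)(B) when H^i(C) = 0, for an arbitrary lift
F of f between arbitrary resolutions.  This freedom allows F to be
multiplication by a ring element on a single resolution.  The proof compares F
with the inclusion into the horseshoe resolution. *)
Lemma vanishes_inj_boundary i (I : injective_resolution A)
    (J : injective_resolution B) (F : forall n, {linear I n -> J n}) :
  (forall x, F 0%N (augmentation I x) = augmentation J (f x)) ->
  (forall n x, F n.+1 (differential I n x) = differential J n (F n x)) ->
  vanishes C i ->
  forall z : I i.+1, z \in gamma a _ -> differential I i.+1 z = 0 ->
  torsion_boundary (F i.+1 z) -> torsion_boundary z.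
Proof.
move=> Faug Fd vC z zt dz Fz.
have [L _] := exists_resolution C.
have [t [e [td ef te]]] := horseshoe_twist fg I L.
pose K := horseshoe fg td ef te.
have [G [Gaug Gd]] := lift_to_resolution J (@resolution_injective _ _ K)
  (augmentation_d K).
have lin n : linear (fun x => G n (F n x) - (x, 0) : K n).
  move=> r x y; rewrite !linearP.
  have -> : (r *: x + y, 0) = r *: (x, 0) + (y, 0) :> (I n * L n)%type.
    by rewrite -[RHS]/(_, _) /= scaler0 addr0.
  by rewrite scalerBr opprD addrACA.
pose D n : {linear I n -> K n} := linear_of (lin n).
have [x|n x|h [h0 hS]] := null_homotopy (@resolution_injective _ _ K) (F := D).
- rewrite /= /linear_fun Faug Gaug [augmentation K _]horseshoe_augE ef.
  have [_ _ /(_ (f x))[_ ->]] := fg; last by exists x.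
  by rewrite linear0 subrr.
- have dx0 : (differential I n x, 0) = differential K n (x, 0).
    by rewrite [RHS]twisted_dE !linear0 addr0.
  rewrite /D /= /linear_fun dx0 Fd Gd.
  exact: (esym (linearB (differential K n) _ _)).
have H := null_homotopic_boundary (F := D) h0 hS zt dz.
have := torsion_boundaryB (torsion_boundary_map Gd Fz) H.
rewrite /D /= /linear_fun subKr => -[[u v] /gamma_pairP[ut vt] uvE].
have [zE dv] : (differential I i u + t i v, differential L i v) = (z, 0) by [].
have := (vanishesP i L).1 vC v vt dv.
case: i u v z zt dz Fz ut vt zE dv {vC H uvE} => [|i] u v z zt dz Fz ut vt zE dv /=.
  by move=> vE; exists u; rewrite // -zE vE linear0 addr0.
move=> [v' v't v'E]; exists (u - t i v'); first by rewrite submoduleB // gamma_linear.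
by rewrite linearB -td v'E.
Qed.

End ShortExact.

(** If H^i(A/xA) = 0, multiplication by x is injective on H^(i+1)(A); but every
element there is killed by a power of x. *)
Lemma vanishes_of_scale A C (x : R) (g : {linear A -> C}) i : x \in a ->
  short_exact (scale_by A x) g -> vanishes C i -> vanishes A i.+1.
Proof.
move=> xa xg vC; have [I _] := exists_resolution A; apply/(vanishesP _ I) => z zt dz.
have xbd (y : I i.+1) : y \in gamma a _ -> differential I i.+1 y = 0 ->
    torsion_boundary (x *: y) -> torsion_boundary y.
  apply: (vanishes_inj_boundary xg (F := fun n => scale_by (I n) x)) => //.
    by move=> u; rewrite !scale_byE linearZ.
  by move=> n u; rewrite !scale_byE linearZ.
have [n xn] := gamma_exp xa zt.
(* x^n z = 0 is a boundary; cancel the factors x one at a time. *)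
have : torsion_boundary (x ^+ n *: z) by rewrite xn; exists 0; rewrite ?rpred0 ?linear0.
elim: n {xn} => [|n IHn]; first by rewrite expr0 scale1r.
rewrite exprS -scalerA => xz; apply: IHn; apply: xbd xz; first exact: rpredZ.
by rewrite linearZ_LR dz scaler0.
Qed.

Lemma vanishes_torsion M i : (forall x : M, x \in gamma a M) -> vanishes M i.+1.
Proof.
move=> MT; have [I /(_ MT) IT] := exists_resolution M.
by apply/(vanishesP _ I) => z _ /resolution_exact[y yz]; exists y; rewrite ?IT.
Qed.

Lemma vanishes_trivial M i : (forall x : M, x = 0) -> vanishes M i.
Proof.
move=> M0; case: i => [|i]; last first.
  by apply: vanishes_torsion => x; rewrite (M0 x) rpred0.
have [I _] := exists_resolution M; apply/(vanishesP _ I) => z _.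
by move=> /augmentation_exact[m <-]; rewrite (M0 m) linear0.
Qed.

Lemma vanishes_iso A B (f : {linear A -> B}) i : injective f ->
  (forall y, exists x, f x = y) -> vanishes B i -> vanishes A i.
Proof.
move=> fi fs; have [I _] := exists_resolution B; move/(vanishesP i I) => acI.
pose aug : {linear A -> I 0%N} := augmentation I \o f.
have augi : injective aug by move=> x y /augmentation_inj/fi.
have augx x : differential I 0 x = 0 <-> exists m, aug m = x.
  rewrite augmentation_exact; split=> -[m <-]; last by exists (f m).
  by have [y <-] := fs m; exists y.
exact/(vanishesP i (InjectiveResolution (@resolution_injective _ _ I) augi augx
  (@resolution_exact _ _ I))).
Qed.


(** Dimension shifting: the negated shift of a resolution I of M is a resolution of
the cokernel of M -> I 0, identified with the coboundaries in I 1. *)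
Section CoboundaryResolution.
Variables (M : lmodType R) (I : injective_resolution M).

Definition coboundaries := image_of (differential I 0) (full_submodule (I 0%N)).

Lemma coboundaries_aug_exact x :
  differential (negated_shift I) 0 x = 0 <->
  exists m, sub_incl coboundaries m = x.
Proof.
rewrite -sub_inclP image_ofP; split=> [|[y _ <-]].
  move=> /eqP; rewrite /= /linear_fun oppr_eq0 => /eqP/resolution_exact[y yx].
  by exists y => //; apply: full_submoduleP.
by rewrite /= /linear_fun differentialK oppr0.
Qed.

Lemma coboundaries_exact n x : differential (negated_shift I) n.+1 x = 0 ->
  exists y, differential (negated_shift I) n y = x.
Proof.
move=> /eqP; rewrite /= /linear_fun oppr_eq0 => /eqP/resolution_exact[y yx].
by exists (- y); rewrite linearN opprK.
Qed.

Definition coboundary_resolution : injective_resolution (submod_type coboundaries) :=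
  InjectiveResolution (resolution := negated_shift I)
    (fun n => @resolution_injective _ _ I n.+1) (@sub_incl_inj _ _ coboundaries)
    coboundaries_aug_exact coboundaries_exact.

End CoboundaryResolution.

(** Every class in H^i(M) comes from a finitely generated submodule N of M.  This
replaces the commutation of local cohomology with direct limits.  For i + 1,
shift dimensions: the class comes from H^i of the coboundaries B^1, hence by
induction from some finitely generated N mapping to B^1.  Lifting generators
of N to I 0 gives a finitely generated E with a surjection g : E -> N whose
kernel embeds into M, and the connecting map of 0 -> ker g -> E -> N -> 0
produces the class on ker g.  Naturality of connecting maps is the homotopy
obtained from [shifted_homotopy]. *)
Lemma cocycle_from_noetherian i M (I : injective_resolution M) (z : I i) :
  z \in gamma a (I i) -> differential I i z = 0 ->
  exists (N : lmodType R) (f : {linear N -> M}) (J : injective_resolution N)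
    (F : forall n, {linear J n -> I n}) (w : J i),
  [/\ injective f /\ noetherian_module N,
      (forall m, F 0%N (augmentation J m) = augmentation I (f m)) /\
      forall n x, F n.+1 (differential J n x) = differential I n (F n x),
      w \in gamma a (J i), differential J i w = 0 &
      torsion_boundary (F i w - z)].
Proof.
elim: i M I z => [|i IHi] M I z zt dz.
  have /augmentation_exact[m mz] := dz.
  pose Rm := image_of (generate m) (full_submodule _).
  have mRm : m \in Rm.
    apply/image_ofP; exists 1; first exact: full_submoduleP.
    by rewrite generateE scale1r.
  have /sub_inclP[m' m'E] := mRm.
  have [J _] := exists_resolution (submod_type Rm).
  have [m0|F [Faug Fd]] := lift_to_resolution J (@resolution_injective _ _ I)
    (phi := augmentation I \o sub_incl Rm); first exact: augmentation_d.
  exists (submod_type Rm), (sub_incl Rm), J, F, (augmentation J m'); split=> //.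
  - split; first exact: sub_incl_inj.
    have lin r : generate m r \in Rm.
      by apply/image_ofP; exists r => //; apply: full_submoduleP.
    apply: (noetherian_surj (g := corestrict lin)) noeR => y.
    by have /image_ofP[r _ ry] := sub_incl_in y; exists r; apply: sub_incl_inj.
  - apply/gamma_linear/(gamma_reflect (@sub_incl_inj _ _ Rm)); rewrite m'E.
    by apply: (gamma_reflect (@augmentation_inj _ _ I)); rewrite mz.
  - exact: augmentation_d.
  - by rewrite /= Faug /= m'E mz subrr.
have [|N [j [L [F0 [w [[ji noeN] [F0aug F0d] wt dw F0w]]]]]] :=
  IHi _ (coboundary_resolution I) z zt.
  by rewrite /= /linear_fun dz oppr0.
pose iota : {linear N -> I 1%N} := sub_incl (coboundaries I) \o j.
have [k [c cP]] := noetherian_module_fg noeN.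
have /choice[b bP] l : exists b, differential I 0 b = iota (c l).
  have /image_ofP[b _ bE] := sub_incl_in (j (c l)).
  by exists b; rewrite bE.
have spanP : is_submodule (fun x : I 0%N * N => exists r : 'I_k -> R,
    x = (\sum_l r l *: b l, \sum_l r l *: c l)).
  split=> [|r _ _ [s ->] [s' ->]].
    by exists (fun=> 0); congr (_, _); rewrite big1 // => l _; rewrite scale0r.
  exists (fun l => r * s l + s' l); rewrite -[LHS]/(_, _) /= !scaler_sumr -!big_split.
  by congr (_, _); apply: eq_bigr => l _; rewrite /= scalerDl scalerA.
pose E := submodule_of spanP.
have lp : linear (fun x => (sub_incl E x).1) by move=> r x y; rewrite linearP.
have lg : linear (fun x => (sub_incl E x).2) by move=> r x y; rewrite linearP.
pose p : {linear submod_type E -> I 0%N} := linear_of lp.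
pose g : {linear submod_type E -> N} := linear_of lg.
have pE x : p x = (sub_incl E x).1 by [].
have gE x : g x = (sub_incl E x).2 by [].
have pg x : differential I 0 (p x) = iota (g x).
  rewrite pE gE; have /submodule_ofP[r ->] := sub_incl_in x.
  by rewrite !linear_sum; apply: eq_bigr => l _; rewrite !linearZ bP.
have bcE l : (b l, c l) \in E.
  apply/submodule_ofP; exists (fun l' => (l' == l)%:R).
  by congr (_, _); rewrite (bigD1 l) //= eqxx scale1r big1 ?addr0 // => l' /negPf ->;
    rewrite scale0r.
have /choice[bc bcP] l : exists x, sub_incl E x = (b l, c l) by apply/sub_inclP.
have gs y : exists x, g x = y.
  have /cP[r ->] : y \in (predT : {pred N}) by [].
  exists (\sum_l r l *: bc l); rewrite linear_sum; apply: eq_bigr => l _.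
  by rewrite linearZ gE bcP.
have pg_inj x y : p x = p y -> g x = g y -> x = y.
  rewrite !pE !gE => pxy gxy; apply: sub_incl_inj.
  by rewrite [LHS]surjective_pairing [RHS]surjective_pairing pxy gxy.
(* E is spanned by the pairs (b l, c l): the b l alone would not determine g. *)
have noeE : noetherian_module (submod_type E).
  apply: noetherian_fg => //; exists k, bc => x; split=> // _.
  have /submodule_ofP[r xE] := sub_incl_in x; exists r; apply: pg_inj.
    rewrite pE xE linear_sum; apply: eq_bigr => l _.
    by rewrite linearZ pE bcP.
  rewrite gE xE linear_sum; apply: eq_bigr => l _.
  by rewrite linearZ gE bcP.
have kg := short_exact_surj gs.
have [x|h hP] := factor_inj (v := p \o sub_incl (kernel g)) (@augmentation_inj _ _ I).
  apply/augmentation_exact; rewrite /= pg.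
  by have /kernelP -> := sub_incl_in x; rewrite linear0.
have hi : injective h.
  move=> x y hxy; apply/sub_incl_inj/pg_inj; first by have := hP x; rewrite hxy hP.
  by have /kernelP -> := sub_incl_in x; have /kernelP -> := sub_incl_in y.
have [J _] := exists_resolution (submod_type (kernel g)).
have [m|F [Faug Fd]] := lift_to_resolution J (@resolution_injective _ _ I)
    (phi := augmentation I \o h); first exact: augmentation_d.
have [t [e [td ef te]]] := horseshoe_twist kg J L.
have lG n : linear (fun v : L n => F n.+1 (t n v) + F0 n v).
  by move=> r x y; rewrite !linearP /= addrACA -scalerDr.
(* On the start N of L, the sum of F t and F0 is the differential of the map
   psi : N -> I 0 with psi (g x) = p x - F (e x). *)
pose G n : {linear L n -> I n.+1} := linear_of (lG n).
have lpsi : linear (fun x => p x - F 0%N (e x)).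
  by move=> r x y; rewrite !linearP /= addrACA -scalerDr.
have [y /kernelP/sub_inclP[x <-]|psi psiP] := factor_surj (v := linear_of lpsi) gs.
  by rewrite /= /linear_fun ef Faug /= hP subrr.
have [y|n x|H HP] := shifted_homotopy (@resolution_injective _ _ I) (G := G) (psi := psi).
- have [x <-] := gs y.
  rewrite psiP /G /= /linear_fun te F0aug linearB pg addrC.
  by congr (_ + _); rewrite linearN Fd.
- by rewrite /G /= /linear_fun F0d td linearN Fd [differential I n.+1 (_ + _)]linearD opprD.
(* The sign is forced by F t + F0 being null-homotopic. *)
exists (submod_type (kernel g)), h, J, F, (- t i w); split=> //.
- split=> //; apply: noetherian_inj noeE; exact: sub_incl_inj.
- by rewrite submoduleN // gamma_linear.
- by rewrite linearN -td dw linear0.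
have := HP i w; rewrite dw linear0 subr0 /G /= /linear_fun.
move=> /(canRL (addKr _)) F0E.
have -> : F i.+1 (- t i w) - z = (F0 i w - z) - differential I i (H i w).
  by rewrite F0E linearN addrAC addrK.
apply: (@torsion_boundaryB I i.+1); last by exists (H i w) => //; apply: gamma_linear.
case: i z w {IHi zt dz wt dw HP F0E} F0w => [|i] z w /=.
  by move=> ->; exists 0; rewrite ?rpred0 ?linear0.
by move=> [y yt <-]; exists (- y); rewrite ?submoduleN // linearN.
Qed.

Lemma vanishes_of_noetherian_submodules i M :
  (forall (N : lmodType R) (f : {linear N -> M}), injective f -> noetherian_module N -> vanishes N i) ->
  vanishes M i.
Proof.
move=> vN; have [I _] := exists_resolution M; apply/(vanishesP _ I) => z zt dz.
have [N [f [J [F [w [[fi noeN] [_ Fd] wt dw Fwz]]]]]] := cocycle_from_noetherian zt dz.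
have Fw : torsion_boundary (F i w).
  apply: (torsion_boundary_map Fd); move/(vanishesP _ J): (vN N f fi noeN).
  exact.
by rewrite -[z](subKr (F i w)); apply: torsion_boundaryB.
Qed.

End Vanishing.

(** * Support and chains of primes *)

Section Support.
Variable R : comPzRingType.
Implicit Types (C M N : lmodType R) (p q : ideal R).

Lemma module_supportP M p : module_support M p <->
  prime_ideal p /\ exists m : M, forall u : R, u *: m = 0 -> u \in p.
Proof.
split=> -[pp [m]].
  move=> [s _ ms]; split=> //; exists m => u um; apply: contrapT => /negP up.
  by apply: ms; exists u; rewrite // scale1r scaler0 subr0.
move=> mp; split=> //; exists m, 1; first by case: pp.
by move=> [u up]; rewrite scale1r scaler0 subr0 => /mp; apply/negP.
Qed.

Lemma module_support_inj M N (f : {linear N -> M}) p :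
  injective f -> module_support N p -> module_support M p.
Proof.
move=> fi /module_supportP[pp [m mp]]; apply/module_supportP; split=> //.
by exists (f m) => u; rewrite -linearZ -(linear0 f) => /fi/mp.
Qed.

Lemma module_support_up M p q : module_support M p -> prime_ideal q ->
  {subset p <= q} -> module_support M q.
Proof.
move=> /module_supportP[_ [m mp]] qq pq; apply/module_supportP; split=> //.
by exists m => u /mp/pq.
Qed.

Lemma module_support_annihilator M p (x : R) :
  module_support M p -> (forall m : M, x *: m = 0) -> x \in p.
Proof. by move=> /module_supportP[_ [m mp]] xM; apply/mp/xM. Qed.

Lemma module_support_quot p q : prime_ideal q -> {subset p <= q} ->
  module_support (quot_mod p) q.
Proof.
move=> qq pq; apply/module_supportP; split=> //; exists (quot_proj p 1) => u.
by rewrite -linearZ => /quot_proj_eq0; rewrite [_ *: _]mulr1 => /pq.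
Qed.

Definition chain_from n p : Prop :=
  exists c : 'I_n.+1 -> ideal R, prime_chain c /\ c ord0 = p.

Lemma chain_from_cons n p q : prime_ideal p -> {subset p <= q} ->
  ~ {subset q <= p} -> chain_from n q -> chain_from n.+1 p.
Proof.
move=> pp pq qp [c [[cp cc] c0]].
have pc j : {subset p <= c j} /\ ~ {subset c j <= p}.
  have [->|j0] := eqVneq j ord0; first by rewrite c0.
  have [cj cj'] : {subset c ord0 <= c j} /\ ~ {subset c j <= c ord0}.
    by apply: cc; rewrite lt0n.
  rewrite c0 in cj cj'; split=> [x /pq/cj //|cjp]; apply: qp => x /cj; exact: cjp.
exists (fun i => if unlift ord0 i is Some j then c j else p).
split; last by rewrite unlift_none.
split=> [i|i j]; first by case: unliftP.
case: (unliftP ord0 i) => [i'|] ->; case: (unliftP ord0 j) => [j'|] -> //=.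
by rewrite /bump /= !add1n ltnS; apply: cc.
Qed.

Lemma chain_from0 p : prime_ideal p -> chain_from 0 p.
Proof. by move=> pp; exists (fun=> p); split=> //; split=> // i j; rewrite !ord1. Qed.

(** Without a minimal element below q, arbitrarily long chains in the support
could be built downwards from q. *)
Lemma minimal_support_below M q n :
  (forall p, ~ chain_from n p) -> module_support M q ->
  exists2 p, minimal_in (module_support M) p & {subset p <= q}.
Proof.
move=> nochain qM; apply: contrapT => nomin.
have [p [pc _ _]] : exists p, [/\ chain_from n p, module_support M p & {subset p <= q}].
  elim: n {nochain} => [|n [p [pc pM pq]]].
    by exists q; split=> //; apply: chain_from0; case: qM.
  have /not_andP[//|/existsNP[p' /not_implyP[p'M /not_implyP[p'p pp']]]] :
    ~ minimal_in (module_support M) p by move=> pmin; apply: nomin; exists p.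
  exists p'; split=> // [|x /p'p /pq //].
  by apply: chain_from_cons pc => //; case: p'M.
exact: nochain pc.
Qed.

(** Choose K maximal among the submodules of M with p in the support of Q = M/K,
and y with annihilator in Q inside p.  By maximality, for each nonzero z in Q
every element of Q is sent into R z by some u outside of p.  For z = r y with
r in p this would put an element outside of p in the annihilator of y; so p
kills y, and R y is a copy of R/p.  For z = y it yields, M being finitely
generated, a single s outside of p with s Q inside R y: the map is
multiplication by s from M to R y. *)
Lemma nonzero_map_to_quotient M p : noetherian_module M -> module_support M p ->
  exists (f : {linear M -> quot_mod p}) (m : M), f m <> 0.
Proof.
move=> noeM /module_supportP[[p1 pM] [m0 m0p]].
have [K [[y yp] Kmax]] := noetherian_max
  (F := fun K => exists y : M, forall u : R, u *: y \in K -> u \in p)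
  (N0 := zero_submodule M) noeM
  (ex_intro _ m0 (fun u um => m0p u ((zero_submoduleP _).1 um))).
have killed z w : z \notin K ->
    exists u, u \notin p /\ exists c, u *: w - c *: z \in K.
  move=> zK; apply: contrapT => nou.
  have Kz : is_submodule (fun x => exists c : R, x - c *: z \in K).
    split=> [|r x x' [c xc] [c' xc']]; first by exists 0; rewrite scale0r subr0 rpred0.
    exists (r * c + c'); rewrite scalerDl opprD addrACA -scalerA -scalerBr.
    by rewrite rpredD ?rpredZ.
  move/negP: zK; apply; apply: (Kmax (submodule_of Kz)).
  - exists w => u /submodule_ofP[c uc]; apply: contrapT => /negP up.
    by apply: nou; exists u; split=> //; exists c.
  - by move=> x xK; apply/submodule_ofP; exists 0; rewrite scale0r subr0.
  - by apply/submodule_ofP; exists 1; rewrite scale1r subrr rpred0.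
(* From u y = c r y in M/K one gets u - c r in p, hence u in p if r is. *)
have py r : r \in p -> r *: y \in K.
  move=> rp; apply: contrapT => /negP ryK.
  have [u [up [c]]] := killed _ y ryK.
  rewrite scalerA -scalerBl => /yp ucr; move/negP: up; apply.
  by rewrite -[u](subrK (c * r)); exact: rpredD ucr (rpredZ c rp).
have [|emb embP] := factor_surj (v := quot_proj K \o generate y) (@quot_proj_surj _ _ p).
  by move=> r /quot_proj_eq0 rp; apply/quot_proj_eq0/py.
have emb_inj : injective emb.
  move=> u v uv; apply/subr0_eq; have := linearB emb u v; rewrite uv subrr.
  have [r <-] := quot_proj_surj (u - v); rewrite embP => /quot_proj_eq0 ry.
  exact/quot_proj_eq0/yp.
have [n [g gP]] := noetherian_module_fg noeM.
have yK : y \notin K.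
  by apply: contraNN p1 => yK; apply: yp; rewrite scale1r.
have /choice[u uP] l := killed y (g l) yK.
pose s : R := \prod_l u l.
have sp : s \notin p.
  rewrite /s; elim/big_ind: _ => //= [x x' xp x'p|l _]; last by case: (uP l).
  by apply/negP => /pM[]; apply/negP.
have sM x : exists c, s *: x - c *: y \in K.
  have /gP[d ->] : x \in (predT : {pred M}) by [].
  have /choice[c cP] l : exists c, s *: g l - c *: y \in K.
    have [_ [c cK]] := uP l; exists ((\prod_(l' | l' != l) u l') * c).
    by rewrite /s (bigD1 l) //= mulrC -!scalerA -scalerBr rpredZ.
  exists (\sum_l d l * c l); rewrite scaler_sumr scaler_suml -sumrB.
  apply: rpred_sum => l _; rewrite scalerA mulrC -!scalerA -scalerBr.
  by rewrite rpredZ.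
have [x|f fP] := factor_inj (v := quot_proj K \o scale_by M s) emb_inj.
  have [c scK] := sM x; exists (quot_proj p c); rewrite embP.
  exact/esym/quot_mod_pi_eq.
exists f, y => fy0; move/negP: sp; apply; apply: yp.
by apply/quot_proj_eq0; rewrite -[RHS](linear0 emb) -fy0 fP.
Qed.

End Support.

Section Devissage.
Variables (R : comPzRingType) (a : ideal R).
Hypothesis noeR : noetherian R.
Implicit Types (C M N : lmodType R) (p q : ideal R).

Lemma vanishes_cyclic C q (g : {linear R^o -> C}) i :
  (forall y, exists x, g x = y) -> (forall r, g r = 0 <-> r \in q) ->
  vanishes a (quot_mod q) i -> vanishes a C i.
Proof.
move=> gs gq.
have [r /gq rq|h hP] := factor_surj (v := quot_proj q) gs; first exact/quot_proj_eq0.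
apply: (vanishes_iso noeR (f := h)).
  move=> u v uv; apply/subr0_eq; have := linearB h u v; rewrite uv subrr.
  by have [r <-] := gs (u - v); rewrite hP => /quot_proj_eq0/gq.
by move=> u; have [r <-] := quot_proj_surj u; exists (g r).
Qed.

(** Devissage.  Let N' be maximal with H^i(N') = 0.  If N' is proper, a maximal
annihilator q of an element y of N/N' is prime and lies in Supp N, and N' + R y
is an extension of R/q by N'. *)
Lemma vanishes_of_support N i : noetherian_module N ->
  (forall q, module_support N q -> vanishes a (quot_mod q) i) -> vanishes a N i.
Proof.
move=> noeN vN.
have [|N' [vN' N'max]] := noetherian_max
  (F := fun N' : submodClosed N => vanishes a (submod_type N') i)
  (N0 := zero_submodule N) noeN.
  apply: vanishes_trivial => // x; apply: sub_incl_inj; rewrite linear0.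
  exact/zero_submoduleP/sub_incl_in.
have [N'full|/existsNP[y0 y0N']] := pselect (forall x, x \in N').
  have N'f x : idfun x \in N' by [].
  apply: (vanishes_iso noeR (f := corestrict N'f)) vN'.
    by move=> x y /(congr1 (sub_incl N')).
  by move=> y; exists (sub_incl N' y); apply: sub_incl_inj.
have [q [[y yN' qE] qmax]] := noetherian_max
  (F := fun q : ideal R => exists2 y, y \notin N' & q = preimage_of (generate y) N')
  noeR (ex_intro2 _ _ y0 (introN idP y0N') erefl).
have qP r : r \in q <-> r *: y \in N' by rewrite qE preimage_ofP.
have q1 : 1 \notin q by apply/negP => /qP; rewrite scale1r; apply/negP.
have qprime : prime_ideal q.
  split=> // u v /qP uvy; have [|/negP vq] := pselect (v \in q); first by right.
  left; apply: (qmax (preimage_of (generate (v *: y)) N')).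
  - by exists (v *: y) => //; apply: contraNN vq => /qP.
  - move=> r /qP ry; apply/preimage_ofP.
    by rewrite generateE scalerA mulrC -scalerA rpredZ.
  - by apply/preimage_ofP; rewrite generateE scalerA.
have qN : module_support N q.
  by apply/module_supportP; split=> //; exists y => u uy; apply/qP; rewrite uy rpred0.
have sumP : is_submodule (fun x => exists2 n, n \in N' & exists r : R, x = n + r *: y).
  split=> [|r _ _ [m mN' [s ->]] [n nN' [t ->]]].
    by exists 0; [exact: rpred0|exists 0; rewrite scale0r addr0].
  exists (r *: m + n); first by rewrite rpredD ?rpredZ.
  by exists (r * s + t); rewrite scalerDr scalerDl scalerA addrACA.
pose N'' := submodule_of sumP.
have inN'' x : sub_incl N' x \in N''.
  apply/submodule_ofP; exists (sub_incl N' x); first exact: sub_incl_in.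
  by exists 0; rewrite scale0r addr0.
have yN'' r : generate y r \in N''.
  by apply/submodule_ofP; exists 0; [exact: rpred0|exists r; rewrite add0r].
have j_inj : injective (corestrict inN'').
  by move=> u v uv; have := congr1 (sub_incl N'') uv;
  rewrite !corestrictK => /sub_incl_inj.
have ex := short_exact_coker j_inj.
have vN'' : vanishes a (submod_type N'') i.
  apply: (vanishes_ext noeR ex vN').
  apply: (vanishes_cyclic (g := quot_proj _ \o corestrict yN'') (q := q)) (vN q qN).
    move=> c; have [x <-] := quot_proj_surj c.
    have /submodule_ofP[n /sub_inclP[n' n'E] [r xE]] := sub_incl_in x.
    exists r; apply/esym/subr0_eq; rewrite /= -linearB.
    have [_ _ /(_ (x - corestrict yN'' r))[_ ->]] // := ex.
    exists n'; apply: sub_incl_inj; rewrite linearB xE corestrictK.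
    by rewrite [sub_incl N'' _]corestrictK generateE addrK.
  move=> r; have [_ _ /(_ (corestrict yN'' r)) H] := ex.
  rewrite qP; apply: iff_trans H _; split=> [[x /(congr1 (sub_incl N''))]|ry].
    by rewrite !corestrictK => xr; rewrite -generateE -xr sub_incl_in.
  have /sub_inclP[x xE] := ry; exists x; apply: sub_incl_inj.
  by rewrite !corestrictK.
exfalso; move/negP: yN'; apply; apply: (N'max N'' vN'').
  by move=> x /sub_inclP[x' <-].
by apply/submodule_ofP; exists 0; [exact: rpred0|exists 1; rewrite scale1r add0r].
Qed.

Lemma noetherian_quot_mod p : noetherian_module (quot_mod p).
Proof. exact: noetherian_surj (@quot_proj_surj _ _ p) noeR. Qed.

Lemma quot_mod_annihilated p (x : R) (u : quot_mod p) : x \in p -> x *: u = 0.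
Proof.
move=> xp; have [r <-] := quot_proj_surj u; rewrite -linearZ.
by apply/quot_proj_eq0; rewrite [_ *: _]mulrC; exact: (rpredZ r xp).
Qed.

(** Grothendieck vanishing for R/p.  If a is contained in p then R/p is torsion.
Otherwise some x in a is a nonzerodivisor on R/p whose cokernel is supported
at primes strictly above p, from which only shorter chains start. *)
Lemma vanishes_above_dim i p :
  prime_ideal p -> ~ chain_from i p -> vanishes a (quot_mod p) i.
Proof.
elim: i p => [|i IHi] p pp nochain; first by case: nochain; apply: chain_from0.
have [ap|/existsNP[x /not_implyP[xa /negP xp]]] := pselect (forall x, x \in a -> x \in p).
  apply: vanishes_torsion => // u; apply: gamma_of_exp => // x /ap xp.
  by exists 1%N; rewrite expr1 quot_mod_annihilated.
have x_inj : injective (scale_by (quot_mod p) x).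
  move=> u v; rewrite !scale_byE => /eqP; rewrite -subr_eq0 -scalerBr => /eqP.
  have [r ruv] := quot_proj_surj (u - v); rewrite -ruv -linearZ => /quot_proj_eq0.
  move=> /(pp.2 x r)[xp'|rp]; first by rewrite xp' in xp.
  by apply/subr0_eq; rewrite -ruv; apply/quot_proj_eq0.
have ex := short_exact_coker x_inj; have [_ gs gE] := ex.
apply: (vanishes_of_scale noeR xa ex); apply: vanishes_of_support.
  exact: noetherian_surj gs (@noetherian_quot_mod p).
move=> q qC; have qq : prime_ideal q by case: qC.
have pq : {subset p <= q}.
  move=> r rp; apply: (module_support_annihilator qC) => c; have [u <-] := gs c.
  by rewrite -linearZ quot_mod_annihilated // linear0.
have xq : x \in q.
  apply: (module_support_annihilator qC) => c; have [u <-] := gs c.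
  by rewrite -linearZ; apply/gE; exists u.
apply: IHi => // qc; apply: nochain; apply: chain_from_cons qc => // qp.
by move: xp; rewrite qp.
Qed.

(** Descending induction on i starting at d; for fixed i, a maximal q in Supp M
with H^i(R/q) <> 0 is refuted with a nonzero map M -> R/q, whose cokernel is
supported at larger primes. *)
Lemma vanishes_quotients_of_support M d k : noetherian_module M ->
  (forall n, (d <= n)%N -> forall p, ~ chain_from n p) ->
  (forall i, (k <= i)%N -> vanishes a M i) ->
  forall i, (k <= i)%N -> forall p, module_support M p -> vanishes a (quot_mod p) i.
Proof.
move=> noeM nochain vM i ki; have : (d <= i + d)%N by rewrite leq_addl.
move: {2}d => j; elim: j i ki => [|j IHj] i ki dij p pM.
  by apply: vanishes_above_dim; [case: pM | apply: nochain; rewrite -[i]addn0].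
apply: contrapT => vp.
have [{vp}q [[qM vq] qmax]] := noetherian_max
  (F := fun p => module_support M p /\ ~ vanishes a (quot_mod p) i) noeR (conj pM vp).
apply: vq; have [f [m fm]] := nonzero_map_to_quotient noeM qM.
pose J := image_of f (full_submodule M).
have fJ x : f x \in J by apply/image_ofP; exists x => //; apply: full_submoduleP.
have fJs y : exists x, corestrict fJ x = y.
  have /image_ofP[x _ xy] := sub_incl_in y.
  by exists x; apply: sub_incl_inj.
have vJ : vanishes a (submod_type J) i.
  apply: (vanishes_surj noeR (short_exact_surj fJs)); first exact: vM.
  apply: vanishes_of_support; first exact: noetherian_inj (@sub_incl_inj _ _ _) noeM.
  move=> q' /(module_support_inj (@sub_incl_inj _ _ _)); apply: IHj.
    exact: leqW.
  by rewrite addSnnS.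
apply: (vanishes_ext noeR (short_exact_quot J) vJ); apply: vanishes_of_support.
  exact: noetherian_surj (@quot_proj_surj _ _ J) (@noetherian_quot_mod q).
move=> q' q'C; have q'q' : prime_ideal q' by case: q'C.
have qq' : {subset q <= q'}.
  move=> r rq; apply: (module_support_annihilator q'C) => c.
  have [u <-] := quot_proj_surj c.
  by rewrite -linearZ quot_mod_annihilated // linear0.
apply: contrapT => vq'; have [s sE] := quot_proj_surj (f m); apply: fm.
(* If H^i(R/q') <> 0 then q' = q by maximality; but q' contains a representative s
   of f m, as s kills the cokernel, so f m = 0. *)
rewrite -sE; apply/quot_proj_eq0; apply: (qmax q') => //.
  by split=> //; apply: module_support_up qM _ qq'.
apply: (module_support_annihilator q'C) => c.
have [u <-] := quot_proj_surj c; have [r <-] := quot_proj_surj u.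
rewrite -!linearZ; apply/quot_proj_eq0.
have -> : quot_proj q (s *: (r : R^o)) = r *: f m.
  by rewrite -sE -linearZ; congr (quot_proj q _); apply: mulrC.
by rewrite rpredZ.
Qed.

End Devissage.

(** * Suprema of sets of natural numbers *)

Section Suprema.
Implicit Type S : set nat.

Definition nat_sup S : \bar int := supremum -oo%E [set (i%:Z)%:E | i in S]%classic.

Lemma nat_sup_max S c : S c -> (forall i, S i -> (i <= c)%N) -> nat_sup S = (c%:Z)%:E.
Proof.
move=> Sc Smax; have cS : [set (i%:Z)%:E | i in S]%classic (c%:Z)%:E by exists c.
have ubc : supremums [set (i%:Z)%:E | i in S]%classic (c%:Z)%:E.
  split=> [_ [i Si <-]|x]; last exact.
  by rewrite lee_fin lez_nat Smax.
rewrite /nat_sup /supremum; case: ifPn => [/eqP S0|_].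
  by rewrite S0 in cS.
case: xgetP => [y _ ySup|/(_ _ ubc)//].
exact: is_subset1_supremums ySup ubc.
Qed.

Lemma nat_sup_unbounded S : (forall c, exists2 i, S i & (c < i)%N) -> nat_sup S = +oo%E.
Proof.
move=> Sunb; have ubc : supremums [set (i%:Z)%:E | i in S]%classic +oo%E.
  split=> [_ [i Si <-]|x ubx]; first exact: leey.
  case: x ubx => [r|//|] ubx.
    have [i Si ri] := Sunb `|r|%N; have := ubx (i%:Z)%:E (ex_intro2 _ _ i Si erefl).
    rewrite lee_fin leNgt; case/negP; apply: le_lt_trans (ler_norm r) _.
    by rewrite -abszE ltz_nat.
  have [i Si _] := Sunb 0%N.
  by have := ubx (i%:Z)%:E (ex_intro2 _ _ i Si erefl).
have [i Si _] := Sunb 0%N; rewrite /nat_sup /supremum; case: ifPn => [/eqP S0|_].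
  have : [set (i%:Z)%:E | i in S]%classic (i%:Z)%:E by exists i.
  by rewrite S0.
case: xgetP => [y _ ySup|/(_ _ ubc)//].
exact: is_subset1_supremums ySup ubc.
Qed.

(** The supremum is a number, -oo or +oo accordingly. *)
Lemma nat_sup_cases S : (exists2 c, S c & forall i, S i -> (i <= c)%N) \/
  (forall i, ~ S i) \/ (forall c, exists2 i, S i & (c < i)%N).
Proof.
have [[c cS]|nobound] := pselect (exists c, forall i, S i -> (i <= c)%N); last first.
  right; right=> c; apply: contrapT => noi; apply: nobound; exists c => i Si.
  by rewrite leqNgt; apply/negP => ci; apply: noi; exists i.
have [[i Si]|/forallNP] := pselect (exists i, S i); last by right; left.
left; have ex : exists i, `[< S i >] by exists i; apply/asboolP.
have bd j : `[< S j >] -> (j <= c)%N by move=> /asboolP/cS.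
case: (ex_maxnP ex bd) => m /asboolP Sm mmax; exists m => // j Sj.
exact/mmax/asboolP.
Qed.

Lemma nat_sup_ge S i : S i -> ((i%:Z)%:E <= nat_sup S)%E.
Proof.
move=> Si; have [[c Sc cmax]|[/(_ i)//|/nat_sup_unbounded ->]] := nat_sup_cases S.
  by rewrite (nat_sup_max Sc cmax) lee_fin lez_nat cmax.
exact: leey.
Qed.

Lemma nat_sup_fin_num S : nat_sup S \is a fin_num ->
  exists2 c, S c & forall i, S i -> (i <= c)%N.
Proof.
have [//|[S0|/nat_sup_unbounded -> //]] := nat_sup_cases S.
rewrite /nat_sup; suff -> : [set (i%:Z)%:E | i in S]%classic = set0 by rewrite supremum0.
by apply/seteqP; split=> // x [i /S0].
Qed.

Lemma nat_sup_bounded S : (nat_sup S < +oo)%E ->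
  exists c, forall i, S i -> (i < c)%N.
Proof.
have [[c _ cmax]|[S0|/nat_sup_unbounded -> //]] := nat_sup_cases S.
  by exists c.+1 => i /cmax.
by exists 0%N => i /S0.
Qed.

End Suprema.

Theorem theorem1p3 (R : comPzRingType) (a : ideal R) (M : lmodType R) :
  noetherian R ->
  (krull_dim R < +oo)%E ->
  cd a M \is a fin_num ->
  (exists2 p : ideal R, module_support M p & (cd a M <= cd a (quot_mod p))%E) /\
  (finitely_generated (predT : {pred M}) ->
   exists2 p : ideal R, minimal_in (module_support M) p & cd a M = cd a (quot_mod p)).
Proof.
move=> noeR dimR /nat_sup_fin_num[c Hc cmax].
have cdE : cd a M = (c%:Z)%:E := nat_sup_max Hc cmax.
have [d nochain] : exists d, forall n, (d <= n)%N -> forall p : ideal R, ~ chain_from n p.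
  have [d dP] := nat_sup_bounded dimR; exists d => n dn p [f [fchain _]].
  by have := dP n (ex_intro _ f fchain); rewrite ltnNge dn.
have [p pM Hp] : exists2 p, module_support M p & local_cohomology_neq0 a (quot_mod p) c.
  apply: contrapT => nop; suff: vanishes a M c by [].
  apply: vanishes_of_noetherian_submodules => // N f fi noeN.
  apply: vanishes_of_support => // q /(module_support_inj fi) qM Hq.
  by apply: nop; exists q.
split; first by exists p; rewrite // cdE; apply: nat_sup_ge.
move=> fgM; have noeM := noetherian_fg noeR fgM.
have [q qmin qp] := minimal_support_below (nochain d (leqnn d)) pM.
have vq i : (c < i)%N -> vanishes a (quot_mod q) i.
  move=> ci; apply: (vanishes_quotients_of_support noeR noeM nochain _ ci).
    by move=> j cj /cmax; rewrite leqNgt cj.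
  by case: qmin.
exists q => //; rewrite cdE; apply/esym/nat_sup_max; last first.
  by move=> i Hi; rewrite leqNgt; apply/negP => /vq.
apply: contrapT => vqc; suff: vanishes a (quot_mod p) c by apply.
apply: (vanishes_quotients_of_support noeR (@noetherian_quot_mod _ noeR q) nochain
  _ (leqnn c)).
  by move=> i; rewrite leq_eqVlt => /predU1P[<- //|/vq].
by apply: module_support_quot qp; case: pM.
Qed.
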